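(* Let $M$ be a $C^1$-manifold modelled on a Fréchet space, $J\subseteq\mathbb{R}$ a non-degenerate interval and $f\colon W\to TM$ a map on an open subset $W\subseteq J\times M$ such that $f(t,y)\in T_yM$ for all $(t,y)\in W$. If the differential equation $\dot{y}(t)=f(t,y(t))$ admits local flows which are pullbacks of $C^1$-maps, then it satisfies local existence of Carathéodory solutions and local uniqueness of Carathéodory solutions.
   Context: **Calculus.** Locally convex spaces are real and Hausdorff. A continuous map $f\colon U\to F$ from an open subset $U$ of a locally convex space $E$ to a locally convex space $F$ is $C^1$ if the directional derivatives $df(x,y)=\frac{d}{dt}|_{t=0}f(x+ty)$ exist for all $(x,y)\in U\times E$ and $df\colon U\times E\to F$ is continuous; it is $C^k$ ($k\ge 2$) if it is $C^1$ and $df$ is $C^{k-1}$; it is $C^\infty$ (smooth) if it is $C^k$ for all $k$. $C^k$-manifolds modelled on locally convex spaces are Hausdorff and defined via charts with this notion. **Absolute continuity.** $\lambda_1$ is Lebesgue–Borel measure. For a Fréchet space $E$ and $a<b$, $\mathcal{L}^1([a,b],E)$ is the set of Borel measurable maps $\gamma\colon[a,b]\to E$ with separable image and $\int_a^b q(\gamma(t))\,dt<\infty$ for each continuous seminorm $q$ on $E$. A map $\eta\colon[a,b]\to E$ is absolutely continuous if there is $\gamma\in\mathcal{L}^1([a,b],E)$ with $\eta(t)=\eta(a)+\int_a^t\gamma(s)\,ds$ (weak integral) for all $t\in[a,b]$; then $\eta'(t)=\gamma(t)$ for almost all $t$. A map on an interval $I$ is absolutely continuous if its restrictions to all $[a,b]\subseteq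 I$, $a<b$, are. If $M$ is a $C^1$-manifold modelled on a Fréchet space, a continuous map $\eta\colon I\to M$ is absolutely continuous if each $t_0\in I$ lies in the interior relative to $I$ of some $[\alpha,\beta]\subseteq I$ for which there is a chart $\phi\colon U_\phi\to V_\phi$ with $\eta([\alpha,\beta])\subseteq U_\phi$ and $\phi\circ\eta|_{[\alpha,\beta]}$ absolutely continuous. A continuous map $\eta\colon I\to M$ is differentiable at $t_0$ if $\phi\circ\eta$ is differentiable at $t_0$ for a chart $\phi$ around $\eta(t_0)$; then $\dot\eta(t_0):=T\phi^{-1}((\phi\circ\eta)(t_0),(\phi\circ\eta)'(t_0))\in T_{\eta(t_0)}M$ (also written $\frac{d\eta}{dt}(t_0)$). **Carathéodory solutions.** A map $\gamma\colon I\to M$ on a non-degenerate interval $I\subseteq\mathbb{R}$ is a Carathéodory solution to $\dot y(t)=f(t,y(t))$ if it is absolutely continuous, $(t,\gamma(t))\in W$ for all $t\in I$ and $\dot\gamma(t)=f(t,\gamma(t))$ for almost all $t\in I$; it solves the initial value problem with $y(t_0)=y_0$ (where $(t_0,y_0)\in W$) if moreover $t_0\in I$ and $\gamma(t_0)=y_0$. *Local existence*: for all $(t_0,y_0)\in W$ there is a Carathéodory solution $\gamma\colon I\to M$ to $\dot y(t)=f(t,y(t))$, $y(t_0)=y_0$ such that $I$ is a relatively open subinterval of $J$. *Local uniqueness*: for all Carathéodory solutions $\gamma_1\colon I_1\to M$, $\gamma_2\colon I_2\to M$ of the differential equation and $t_0\in I_1\cap I_2$ with $\gamma_1(t_0)=\gamma_2(t_0)$,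 there is an interval $K\subseteq\mathbb{R}$ which is an open neighbourhood of $t_0$ in $I_1\cap I_2$ such that $\gamma_1|_K=\gamma_2|_K$. **Local flows which are pullbacks of $C^k$-maps** ($k\in\mathbb{N}\cup\{\infty\}$, $M$ a $C^k$-manifold modelled on a Fréchet space): for all $(\bar t,\bar y)\in W$ there exist a relatively open interval $I\subseteq J$ with $\bar t\in I$, an open neighbourhood $V$ of $\bar y$ in $M$ with $I\times V\subseteq W$ and a function $\Phi\colon I\times I\times V\to M$, $\Phi_{t,t_0}(y_0):=\Phi(t,t_0,y_0)$, such that: (a) for all $(t_0,y_0)\in I\times V$, the map $I\to M$, $t\mapsto\Phi_{t,t_0}(y_0)$ is a Carathéodory solution to $\dot y(t)=f(t,y(t))$, $y(t_0)=y_0$; (b) there is an open $\bar y$-neighbourhood $Y\subseteq V$ such that $\Phi_{t_1,t_0}(Y)\subseteq V$ for all $t_0,t_1\in I$ and $\Phi_{t_2,t_1}(\Phi_{t_1,t_0}(y_0))=\Phi_{t_2,t_0}(y_0)$ for all $t_0,t_1,t_2\in I$, $y_0\in Y$; (c) there exist $C^k$-manifolds $N_1,N_2$ modelled on Fréchet spaces, absolutely continuous maps $\zeta_j\colon I\to N_j$ for $j\in\{1,2\}$ and a $C^k$-map $\Psi\colon N_1\times N_2\times V\to M$ with $\Phi(t,t_0,y_0)=\Psi(\zeta_1(t),\zeta_2(t_0),y_0)$ for all $(t,t_0,y_0)\in I\times I\times V$; moreover there is a Borel set $I_0\subseteq I$ with $\lambda_1(I\setminus I_0)=0$ such that $\frac{d}{dt}\Phi_{t,t_0}(y_0)$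 exists and equals $f(t,\Phi_{t,t_0}(y_0))$ for all $y_0\in V$, $t_0\in I$, $t\in I_0$. *)

(* Defs.v *)
From HB Require Import structures.
From mathcomp Require Import all_boot all_order all_algebra.
From mathcomp Require Import all_classical all_reals all_analysis.

Set Implicit Arguments.
Unset Strict Implicit.
Unset Printing Implicit Defensive.

Import Order.TTheory GRing.Theory Num.Theory.
Import numFieldNormedType.Exports.

Local Open Scope classical_set_scope.
Local Open Scope ring_scope.

(** A map defined on a subset [A] of a type is represented by a total function
    of which only the values on [A] matter. *)

(** [tvsType R] is a locally convex space, not necessarily Hausdorff.  Its
    uniform structure is only required to induce the topology, so Cauchy
    filters are defined from the neighbourhoods of 0, not from [entourage]. *)

Definition metrizable {R : realType} (T : topologicalType) : Prop :=
  exists d : T -> T -> R,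
    [/\ forall x y, 0 <= d x y /\ (d x y = 0 <-> x = y),
        forall x y, d x y = d y x,
        forall x y z, d x z <= d x y + d y z
      & forall x, nbhs x =
          filter_from [set e : R | 0 < e] (fun e => [set y | d x y < e])].

Definition tvs_cauchy (R : realType) (E : tvsType R) (F : set_system E) : Prop :=
  forall U : set E, nbhs (0 : E) U ->
    exists2 A : set E, F A & forall x y, A x -> A y -> U (x - y).

Definition tvs_complete (R : realType) (E : tvsType R) : Prop :=
  forall F : set_system E, ProperFilter F -> tvs_cauchy F ->
    exists x : E, F --> x.

Definition frechet (R : realType) (E : tvsType R) : Prop :=
  @metrizable R E /\ tvs_complete E.

Definition has_dirderiv (R : realType) (E F : tvsType R)
    (f : E -> F) (x y : E) (w : F) : Prop :=
  h^-1 *: (f (x + h *: y) - f x) @[h --> (0 : R)^'] --> w.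

(** [U] is meant to be open: the derivatives use the values of [f] near each
    point of [U]. *)
Definition C1_on (R : realType) (E F : tvsType R)
    (U : set E) (f : E -> F) : Prop :=
  {within U, continuous f} /\
  exists2 df : E * E -> F,
    forall x y, U x -> has_dirderiv f x y (df (x, y))
  & {within U `*` [set: E], continuous df}.

Record chart (R : realType) (M : topologicalType) (E : tvsType R) := Chart {
  cdom : set M;
  ccod : set E;
  cfun :> M -> E;
  cinv : E -> M;
  cdom_open : open cdom;
  ccod_open : open ccod;
  cfun_cod : forall y, cdom y -> ccod (cfun y);
  cinv_dom : forall v, ccod v -> cdom (cinv v);
  cfunK : forall y, cdom y -> cinv (cfun y) = y;
  cinvK : forall v, ccod v -> cfun (cinv v) = v;
  cfun_continuous : {within cdom, continuous cfun};
  cinv_continuous : {within ccod, continuous cinv} }.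

Definition C1_transition (R : realType) (M : topologicalType) (E : tvsType R)
    (c c' : chart M E) : Prop :=
  C1_on (c @` (cdom c `&` cdom c')) (c' \o cinv c).

Definition C1_compatible (R : realType) (M : topologicalType) (E : tvsType R)
    (c c' : chart M E) : Prop :=
  C1_transition c c' /\ C1_transition c' c.

Record C1manifold (R : realType) (E : tvsType R) := C1Manifold {
  mcarrier :> topologicalType;
  atlas : set (chart mcarrier E);
  model_hausdorff : hausdorff_space E;
  manifold_hausdorff : hausdorff_space mcarrier;
  atlas_cover : forall y : mcarrier, exists2 c, atlas c & cdom c y;
  atlas_compatible : forall c c', atlas c -> atlas c' -> C1_compatible c c' }.

(** Membership in the maximal atlas containing [atlas M]. *)
Definition is_chart (R : realType) (E : tvsType R) (M : C1manifold E)
    (c : chart M E) : Prop :=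
  forall c', atlas c' -> C1_compatible c c'.

(** [O] is meant to be open. *)
Definition C1_map_on (R : realType) (E F : tvsType R)
    (N : C1manifold E) (M : C1manifold F) (O : set N) (f : N -> M) : Prop :=
  {within O, continuous f} /\
  forall (c : chart N E) (d : chart M F), is_chart c -> is_chart d ->
    C1_on (c @` (cdom c `&` O `&` f @^-1` cdom d)) (d \o f \o cinv c).

Lemma hausdorff_pair (X Y : topologicalType) :
  hausdorff_space X -> hausdorff_space Y -> hausdorff_space (X * Y)%type.
Proof.
move=> hX hY [x y] [x' y'] xy; congr pair.
- apply: hX => A B nA nB.
  have nA' : nbhs (x, y) (A `*` setT).
    by exists (A, setT) => //; split => //; exact: filterT.
  have nB' : nbhs (x', y') (B `*` setT).
    by exists (B, setT) => //; split => //; exact: filterT.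
  by have [[u v] /= [[Au _] [Bu _]]] := xy _ _ nA' nB'; exists u.
- apply: hY => A B nA nB.
  have nA' : nbhs (x, y) (setT `*` A).
    by exists (setT, A) => //; split => //; exact: filterT.
  have nB' : nbhs (x', y') (setT `*` B).
    by exists (setT, B) => //; split => //; exact: filterT.
  by have [[u v] /= [[_ Av] [_ Bv]]] := xy _ _ nA' nB'; exists v.
Qed.

Lemma open_setX (X Y : topologicalType) (A : set X) (B : set Y) :
  open A -> open B -> open (A `*` B).
Proof.
move=> oA oB; rewrite openE => -[x y] [/= Ax By].
by exists (A, B) => //; split; exact: open_nbhs_nbhs.
Qed.

Lemma within_continuous_pair (X Y X' Y' : topologicalType)
    (A : set X) (B : set Y) (f : X -> X') (g : Y -> Y') :
  {within A, continuous f} -> {within B, continuous g} ->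
  {within A `*` B, continuous (fun p : X * Y => (f p.1, g p.2))}.
Proof.
move=> /subspace_continuousP cf /subspace_continuousP cg.
apply/subspace_continuousP => -[x y] [/= Ax By].
apply: cvg_pair => /=.
- move=> U /(cf _ Ax); rewrite /= !nbhs_simpl /within /= => nU.
  exists ([set z | A z -> U (f z)], setT); first by split => //; exact: filterT.
  by move=> [u v] /= [+ _] [Au _]; exact.
- move=> U /(cg _ By); rewrite /= !nbhs_simpl /within /= => nU.
  exists (setT, [set z | B z -> U (g z)]); first by split => //; exact: filterT.
  by move=> [u v] /= [_ +] [_ Bv]; exact.
Qed.

Lemma C1_on_pair (R : realType) (E1 E2 F1 F2 : tvsType R)
    (U1 : set E1) (U2 : set E2) (f1 : E1 -> F1) (f2 : E2 -> F2) :
  C1_on U1 f1 -> C1_on U2 f2 ->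
  C1_on (U1 `*` U2) (fun p : E1 * E2 => (f1 p.1, f2 p.2)).
Proof.
move=> [cf1 [df1 hdf1 cdf1]] [cf2 [df2 hdf2 cdf2]].
split; first exact: within_continuous_pair.
exists (fun p : (E1 * E2) * (E1 * E2) =>
  (df1 (p.1.1, p.2.1), df2 (p.1.2, p.2.2))).
- move=> [x1 x2] [y1 y2] [/= U1x U2x].
  exact: (cvg_pair (hdf1 x1 y1 U1x) (hdf2 x2 y2 U2x)).
- have /subspace_continuousP cp := within_continuous_pair cdf1 cdf2.
  apply/subspace_continuousP => -[[x1 x2] [y1 y2]] [/= [U1x U2x] _].
  have /= := cp ((x1, y1), (x2, y2)) (conj (conj U1x I) (conj U2x I)).
  move=> h; apply: cvg_trans h.
  move=> P /=; rewrite !nbhs_simpl /within /= => -[[Q1 Q2] /=].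
  move=> [[[A1 B1] /= [nA1 nB1] AB1] [[A2 B2] /= [nA2 nB2] AB2]] QP.
  exists (A1 `*` A2, B1 `*` B2).
    by split; [exists (A1, A2)|exists (B1, B2)].
  move=> [[u1 u2] [v1 v2]] /= [[A1u A2u] [B1v B2v]] [[U1u U2u] _].
  apply: (QP ((u1, v1), (u2, v2))) => //.
  by split; [exact: (AB1 (u1, v1))|exact: (AB2 (u2, v2))].
Qed.

Definition prod_chart (R : realType) (M1 M2 : topologicalType)
    (E1 E2 : tvsType R) (c1 : chart M1 E1) (c2 : chart M2 E2) :
  chart (M1 * M2)%type (E1 * E2)%type.
Proof.
refine (@Chart R (M1 * M2)%type (E1 * E2)%type
  (cdom c1 `*` cdom c2) (ccod c1 `*` ccod c2)
  (fun p => (c1 p.1, c2 p.2)) (fun q => (cinv c1 q.1, cinv c2 q.2))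
  _ _ _ _ _ _ _ _).
- by apply: open_setX; exact: cdom_open.
- by apply: open_setX; exact: ccod_open.
- by move=> [y1 y2] [/= h1 h2]; split; exact: cfun_cod.
- by move=> [y1 y2] [/= h1 h2]; split; exact: cinv_dom.
- by move=> [y1 y2] [/= h1 h2]; rewrite !cfunK.
- by move=> [y1 y2] [/= h1 h2]; rewrite !cinvK.
- by apply: within_continuous_pair; exact: cfun_continuous.
- by apply: within_continuous_pair; exact: cinv_continuous.
Defined.

Lemma C1_transition_prod (R : realType) (M1 M2 : topologicalType)
    (E1 E2 : tvsType R) (c1 c1' : chart M1 E1) (c2 c2' : chart M2 E2) :
  C1_transition c1 c1' -> C1_transition c2 c2' ->
  C1_transition (prod_chart c1 c2) (prod_chart c1' c2').
Proof.
move=> h1 h2; rewrite /C1_transition.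
have -> : prod_chart c1 c2 @`
    (cdom (prod_chart c1 c2) `&` cdom (prod_chart c1' c2')) =
    (c1 @` (cdom c1 `&` cdom c1')) `*` (c2 @` (cdom c2 `&` cdom c2')).
  apply/seteqP; split => [_ [[y1 y2] /= [[a1 a2] [b1 b2]] <-]|].
    by split; [exists y1|exists y2].
  move=> [_ _] [/= [y1 [a1 b1] <-] [y2 [a2 b2] <-]].
  by exists (y1, y2).
exact: (C1_on_pair h1 h2).
Qed.

Definition prod_manifold (R : realType) (E1 E2 : tvsType R)
    (M1 : C1manifold E1) (M2 : C1manifold E2) : C1manifold (E1 * E2)%type.
Proof.
refine (@C1Manifold R (E1 * E2)%type (M1 * M2)%type
  [set c | exists c1 c2, [/\ @atlas _ _ M1 c1, @atlas _ _ M2 c2 &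
                             c = prod_chart c1 c2]] _ _ _ _).
- by apply: hausdorff_pair; exact: model_hausdorff.
- by apply: hausdorff_pair; exact: manifold_hausdorff.
- move=> [y1 y2].
  have [c1 a1 h1] := atlas_cover y1; have [c2 a2 h2] := atlas_cover y2.
  by exists (prod_chart c1 c2) => //; exists c1, c2.
- move=> _ _ [c1 [c2 [a1 a2 ->]]] [c1' [c2' [a1' a2' ->]]].
  have [h1 h1'] := atlas_compatible a1 a1'.
  have [h2 h2'] := atlas_compatible a2 a2'.
  by split; exact: C1_transition_prod.
Defined.

(** A tangent vector at [y] is an equivalence class of pairs [(c, v)], where
    [c] is a chart around [y] and [v] a vector of the model space: [(c, v)] and
    [(c', v')] are equivalent if [v'] is the derivative of the change of charts
    from [c] to [c'] at [c y] in the direction [v]. *)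
Definition tangent_class (R : realType) (E : tvsType R) (M : C1manifold E)
    (c : chart M E) (y : M) (v : E) : set (chart M E * E) :=
  [set p | [/\ is_chart p.1, cdom p.1 y &
               has_dirderiv (p.1 \o cinv c) (c y) v p.2]].

Record tangent_bundle (R : realType) (E : tvsType R) (M : C1manifold E) :=
  TangentVector {
    tbase : M;
    tclass : set (chart M E * E);
    tclassP : exists c v,
      [/\ is_chart c, cdom c tbase & tclass = tangent_class c tbase v] }.

Lemma tangent_classP (R : realType) (E : tvsType R) (M : C1manifold E)
    (c : chart M E) (y : M) (v : E) (hc : is_chart c) (hy : cdom c y) :
  exists c' v', [/\ is_chart c', cdom c' y &
    tangent_class c y v = tangent_class c' y v'].
Proof. by exists c, v. Qed.

(** [chart_tangent hc hy v] is T(c^-1)(c y, v), an element of the tangent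
    space at [y]. *)
Definition chart_tangent (R : realType) (E : tvsType R) (M : C1manifold E)
    (c : chart M E) (y : M) (hc : is_chart c) (hy : cdom c y) (v : E) :
    tangent_bundle M :=
  TangentVector (tangent_classP v hc hy).

Definition nondegenerate_interval (R : realType) (I : set R) : Prop :=
  is_interval I /\ exists a b, [/\ I a, I b & a < b].

Definition relatively_open (T : topologicalType) (X A : set T) : Prop :=
  exists2 O : set T, open O & A = X `&` O.

Definition continuous_seminorm (R : realType) (E : tvsType R) (q : E -> R) : Prop :=
  [/\ forall x y, q (x + y) <= q x + q y,
      forall (a : R) x, q (a *: x) = `|a| * q x
    & continuous q].

Definition separable_set (T : topologicalType) (S : set T) : Prop :=
  exists D : set T, [/\ countable D, D `<=` S & S `<=` closure D].

Definition L1_path (R : realType) (E : tvsType R) (a b : R) (g : R -> E) : Prop :=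
  [/\ forall B : set E, <<s @open E >> B ->
        measurable (`[a, b]%classic `&` g @^-1` B),
      separable_set (g @` `[a, b]%classic)
    & forall q : E -> R, continuous_seminorm q ->
        (\int[lebesgue_measure]_(t in `[a, b]%classic) (q (g t))%:E < +oo)%E].

Definition is_weak_integral (R : realType) (E : tvsType R)
    (a t : R) (g : R -> E) (w : E) : Prop :=
  forall l : {linear E -> R^o}, continuous l ->
    (l w)%:E = (\int[lebesgue_measure]_(s in `[a, t]%classic) (l (g s))%:E)%E.

Definition abs_continuous_seg (R : realType) (E : tvsType R)
    (a b : R) (eta : R -> E) : Prop :=
  exists2 g : R -> E, L1_path a b g &
    forall t, a <= t <= b -> is_weak_integral a t g (eta t - eta a).

Definition abs_continuous (R : realType) (E : tvsType R) (M : C1manifold E)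
    (I : set R) (eta : R -> M) : Prop :=
  {within I, continuous eta} /\
  forall t0, I t0 ->
    exists (alpha beta : R) (c : chart M E),
      [/\ alpha < beta,
          `[alpha, beta]%classic `<=` I,
          within I (nbhs t0) `[alpha, beta]%classic,
          is_chart c
        & (forall t, alpha <= t <= beta -> cdom c (eta t)) /\
          abs_continuous_seg alpha beta (c \o eta)].

(** One-sided at an end point of [I]. *)
Definition has_deriv_in (R : realType) (E : tvsType R)
    (I : set R) (g : R -> E) (t : R) (v : E) : Prop :=
  h^-1 *: (g (t + h) - g t)
    @[h --> within [set h | I (t + h)] (0 : R)^'] --> v.

Definition has_velocity (R : realType) (E : tvsType R) (M : C1manifold E)
    (I : set R) (eta : R -> M) (t : R) (X : tangent_bundle M) : Prop :=
  exists (c : chart M E) (hc : is_chart c) (hy : cdom c (eta t)) (v : E),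
    has_deriv_in I (c \o eta) t v /\ X = chart_tangent hc hy v.

Section differential_equation.
Variables (R : realType) (E : tvsType R) (M : C1manifold E).
Variables (J : set R) (W : set (R * M)) (f : R * M -> tangent_bundle M).

Definition caratheodory_solution (I : set R) (gamma : R -> M) : Prop :=
  [/\ nondegenerate_interval I,
      abs_continuous I gamma,
      forall t, I t -> W (t, gamma t)
    & {ae lebesgue_measure, forall t, I t ->
        has_velocity I gamma t (f (t, gamma t))}].

Definition caratheodory_ivp_solution (t0 : R) (y0 : M)
    (I : set R) (gamma : R -> M) : Prop :=
  [/\ caratheodory_solution I gamma, I t0 & gamma t0 = y0].

Definition local_existence : Prop :=
  forall t0 y0, W (t0, y0) ->
    exists (I : set R) (gamma : R -> M),
      relatively_open J I /\ caratheodory_ivp_solution t0 y0 I gamma.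

Definition local_uniqueness : Prop :=
  forall (I1 I2 : set R) (gamma1 gamma2 : R -> M) (t0 : R),
    caratheodory_solution I1 gamma1 -> caratheodory_solution I2 gamma2 ->
    I1 t0 -> I2 t0 -> gamma1 t0 = gamma2 t0 ->
    exists K : set R,
      [/\ is_interval K, K t0, relatively_open (I1 `&` I2) K
        & forall t, K t -> gamma1 t = gamma2 t].

(** A local flow [Phi : I * I * V -> M]: [Phi t t0 y0] is the value at time [t]
    of the solution with value [y0] at time [t0]. *)

Definition flow_solves (I : set R) (V : set M) (Phi : R -> R -> M -> M) : Prop :=
  forall t0 y0, I t0 -> V y0 ->
    caratheodory_ivp_solution t0 y0 I (fun t => Phi t t0 y0).

Definition flow_composes (yb : M) (I : set R) (V : set M)
    (Phi : R -> R -> M -> M) : Prop :=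
  exists Y : set M,
    [/\ open Y, Y yb, Y `<=` V,
        forall t0 t1 y, I t0 -> I t1 -> Y y -> V (Phi t1 t0 y)
      & forall t0 t1 t2 y0, I t0 -> I t1 -> I t2 -> Y y0 ->
          Phi t2 t1 (Phi t1 t0 y0) = Phi t2 t0 y0].

Definition flow_pullback_C1 (I : set R) (V : set M)
    (Phi : R -> R -> M -> M) : Prop :=
  (exists (E1 E2 : tvsType R) (N1 : C1manifold E1) (N2 : C1manifold E2)
      (zeta1 : R -> N1) (zeta2 : R -> N2)
      (Psi : prod_manifold (prod_manifold N1 N2) M -> M),
    [/\ frechet E1 /\ frechet E2,
        abs_continuous I zeta1,
        abs_continuous I zeta2,
        C1_map_on (N := prod_manifold (prod_manifold N1 N2) M)
          (([set: N1] `*` [set: N2]) `*` V) Psi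
      & forall t t0 y0, I t -> I t0 -> V y0 ->
          Phi t t0 y0 = Psi ((zeta1 t, zeta2 t0), y0)]) /\
  (exists I0 : set R,
    [/\ measurable I0, I0 `<=` I, lebesgue_measure (I `\` I0) = 0%E
      & forall t t0 y0, I0 t -> I t0 -> V y0 ->
          has_velocity I (fun s => Phi s t0 y0) t (f (t, Phi t t0 y0))]).

Definition local_flows_pullback_C1 : Prop :=
  forall tb yb, W (tb, yb) ->
    exists (I : set R) (V : set M) (Phi : R -> R -> M -> M),
      [/\ is_interval I, relatively_open J I & I tb] /\
      [/\ open V, V yb & I `*` V `<=` W] /\
      [/\ flow_solves I V Phi, flow_composes yb I V Phi
        & flow_pullback_C1 I V Phi].

End differential_equation.

(* Main.v *)
Require Import Defs.
From HB Require Import structures.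
From mathcomp Require Import all_boot all_order all_algebra.
From mathcomp Require Import all_classical all_reals all_analysis.
From mathcomp Require Import measurable_realfun ring lra.

Set Implicit Arguments.
Unset Strict Implicit.
Unset Printing Implicit Defensive.

Import Order.TTheory GRing.Theory Num.Theory.
Import numFieldNormedType.Exports.

Local Open Scope classical_set_scope.
Local Open Scope ring_scope.

(** Local existence is contained in the notion of a local flow.  For uniqueness,
    let [gamma] be a Caratheodory solution and [Phi] a local flow around
    [(t0, gamma t0)].  The curve [eta s = Phi t0 s (gamma s)] transports
    [gamma s] back to time [t0] along the flow.  It is constant near [t0], hence
    equal to [gamma t0], and applying [Phi t t0] gives
    [gamma t = Phi t t0 (gamma t0)].  The right hand side depends only on the
    initial value, so two solutions with the same value at [t0] agree near [t0].

    The curve [eta] is constant because, read in a chart, it is absolutely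
    continuous with derivative zero almost everywhere:

    - [Phi t0 s x = Psi (zeta1 t0, zeta2 s, x)] with a C1 map [Psi], and C1 maps
      are locally Lipschitz with respect to suitable continuous seminorms
      ([C1_on_lipschitz], [pullback_lipschitz]).  As the increments of [zeta2]
      and [gamma] are bounded by integrals ([weak_integral_csn_le]), so are
      those of [eta].

    - At almost every time [s], the flow line [kappa t = Phi t s (gamma s)] has
      the same velocity [f (s, gamma s)] as [gamma], so that [gamma t] and
      [kappa t] differ by [o(t - s)] in a chart.  Since [Phi t0 t (kappa t)] is
      the constant [eta s] by the composition law, the Lipschitz estimate in the
      last variable alone shows that [eta t] and [eta s] differ by [o(t - s)]
      ([pulled_back_derivative]).

    Everything is measured by one continuous seminorm at a time, so that the
    vanishing of the derivative leads to a statement on real numbers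
    ([null_derivative_increment]); in a Hausdorff locally convex space the
    seminorms separate points.  Continuous seminorms are obtained as gauges
    ([csn_below_nbhs]), and the Hahn-Banach theorem supplies, for a given vector,
    a functional that norms it ([csn_dual]); this reduces the Lipschitz estimate
    to the mean value theorem and the estimate for weak integrals to the scalar
    case. *)

(** * The Hahn-Banach theorem for seminorms *)

Lemma seminorm0 (R : realType) (E : lmodType R) (p : E -> R) :
  (forall a x, p (a *: x) = `|a| * p x) -> p 0 = 0.
Proof. by move=> h; rewrite -(scale0r (0 : E)) h normr0 mul0r. Qed.

Lemma seminormN (R : realType) (E : lmodType R) (p : E -> R) :
  (forall a x, p (a *: x) = `|a| * p x) -> forall x, p (- x) = p x.
Proof. by move=> h x; rewrite -scaleN1r h normrN1 mul1r. Qed.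

Lemma seminorm_ge0 (R : realType) (E : lmodType R) (p : E -> R) :
  (forall x y, p (x + y) <= p x + p y) ->
  (forall a x, p (a *: x) = `|a| * p x) -> forall x, 0 <= p x.
Proof.
move=> hD hZ x; have := hD x (- x).
by rewrite subrr (seminorm0 hZ) (seminormN hZ); lra.
Qed.

(** A partially defined linear functional below [p], encoded by its graph so that
    Zorn's lemma applies to sets.  The bound implies that [G] is single-valued, as
    [p 0 = 0]. *)
Definition dominated_graph (R : realType) (E : lmodType R) (p : E -> R)
    (G : set (E * R)) : Prop :=
  (forall (a : R) u v, G u -> G v -> G (a *: u.1 + v.1, a * u.2 + v.2)) /\
  (forall u, G u -> u.2 <= p u.1).

(** One more dimension: by subadditivity, the lower bounds [r - p (x - y)] for
    the value [c] at [y] lie below the upper bounds [p (x + y) - r], so the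
    supremum of the former is an admissible value. *)
Lemma dominated_graph_extend (R : realType) (E : lmodType R) (p : E -> R)
    (G : set (E * R)) (y : E) :
  (forall x y, p (x + y) <= p x + p y) ->
  (forall a x, p (a *: x) = `|a| * p x) ->
  dominated_graph p G -> G (0, 0) ->
  exists c : R, dominated_graph p
    [set w | exists u t, G u /\ w = (u.1 + t *: y, u.2 + t * c)].
Proof.
move=> pD pZ [Glin Gp] G0.
have GB u v : G u -> G v -> G (u.1 + v.1, u.2 + v.2).
  by move=> Gu Gv; have := Glin 1 _ _ Gu Gv; rewrite scale1r mul1r.
have GZ a u : G u -> G (a *: u.1, a * u.2).
  by move=> Gu; have := Glin a _ _ Gu G0; rewrite /= !addr0.
pose L : set R := [set u.2 - p (u.1 - y) | u in G].
have LU u v : G u -> G v -> u.2 - p (u.1 - y) <= p (v.1 + y) - v.2.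
  move=> Gu Gv; have := Gp _ (GB _ _ Gu Gv) => /=.
  have -> : u.1 + v.1 = (u.1 - y) + (v.1 + y) by rewrite addrACA addNr addr0.
  by have := pD (u.1 - y) (v.1 + y); lra.
have L0 : L !=set0 by exists (0 - p (0 - y)), (0, 0).
have Lub v : G v -> ubound L (p (v.1 + y) - v.2).
  by move=> Gv _ [u Gu <-]; exact: LU.
pose c := sup L.
have hL u : G u -> u.2 - p (u.1 - y) <= c.
  move=> Gu; apply: ub_le_sup; last by exists u.
  by exists (p (0 + y) - 0); exact: (Lub (0, 0)).
have hU v : G v -> c <= p (v.1 + y) - v.2.
  by move=> Gv; apply: ge_sup => //; exact: Lub.
exists c; split.
- move=> a _ _ [u [t [Gu ->]]] [v [s [Gv ->]]] /=.
  exists (a *: u.1 + v.1, a * u.2 + v.2), (a * t + s); split; first exact: Glin.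
  congr pair => /=; last by ring.
  by rewrite scalerDr scalerDl scalerA addrACA.
- move=> _ [u [t [Gu ->]]] /=.
  have [t0|t0|->] := ltgtP t 0; last first.
  + by rewrite scale0r mul0r !addr0; exact: Gp.
  + have := hU _ (GZ t^-1 _ Gu) => /=.
    have -> : u.1 + t *: y = t *: (t^-1 *: u.1 + y).
      by rewrite scalerDr scalerA divff ?scale1r// gt_eqF.
    rewrite pZ gtr0_norm// => h.
    have : t * (c + t^-1 * u.2) <= t * p (t^-1 *: u.1 + y).
      by rewrite ler_pM2l//; lra.
    by rewrite mulrDr mulrA divff ?gt_eqF//; lra.
  + have := hL _ (GZ (- t)^-1 _ Gu) => /=.
    have tN : 0 < - t by rewrite oppr_gt0.
    have -> : u.1 + t *: y = (- t) *: ((- t)^-1 *: u.1 - y).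
      rewrite scalerDr scalerA divff ?gt_eqF// scale1r scalerN scaleNr.
      by rewrite opprK.
    rewrite pZ gtr0_norm// => h.
    have : - t * ((- t)^-1 * u.2 - c) <= - t * p ((- t)^-1 *: u.1 - y).
      by rewrite ler_pM2l//; lra.
    by rewrite mulrBr mulrA divff ?gt_eqF//; lra.
Qed.

(** By Zorn's lemma there is a maximal dominated graph through [(x0, p x0)]; the
    extension by one dimension shows that its domain is the whole space. *)
Theorem hahn_banach (R : realType) (E : lmodType R) (p : E -> R) (x0 : E) :
  (forall x y, p (x + y) <= p x + p y) ->
  (forall a x, p (a *: x) = `|a| * p x) ->
  exists l : {linear E -> R^o}, l x0 = p x0 /\ forall x, `|l x| <= p x.
Proof.
move=> pD pZ; have p0 := seminorm_ge0 pD pZ.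
pose P (G : set (E * R)) :=
  dominated_graph p G /\ forall u, G u -> G (x0, p x0).
pose G0 : set (E * R) := [set u | exists t, u = (t *: x0, t * p x0)].
have PG0 : P G0.
  split; last by move=> _ _; exists 1; rewrite scale1r mul1r.
  split=> [a _ _ [t ->] [s ->]|_ [t ->]] /=.
    exists (a * t + s); rewrite scalerDl scalerA.
    by congr pair; ring.
  by rewrite pZ ler_wpM2r// ler_norm.
(* The union of the empty chain is empty, so [P] only asks nonempty graphs to
   pass through [(x0, p x0)]. *)
have [G [[[Glin Gp] Gx0] Gmax]] : exists A, P A /\ forall B, A `<` B -> ~ P B.
  apply: Zorn_bigcup => F FP Ftot; split; first split.
  - move=> a u v [A FA Au] [B FB Bv].
    have [AB|BA] := Ftot _ _ FA FB.
      by exists B => //; apply: (FP _ FB).1.1 => //; exact: AB.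
    by exists A => //; apply: (FP _ FA).1.1 => //; exact: BA.
  - by move=> u [A FA Au]; exact: (FP _ FA).1.2.
  - by move=> u [A FA Au]; exists A => //; exact: (FP _ FA).2 Au.
have Gne : exists u, G u.
  apply: contrapT => Ge; apply: (Gmax G0) => //.
  split; first by move=> u Gu; exfalso; apply: Ge; exists u.
  move=> h; apply: Ge; exists (x0, p x0); apply: h.
  by exists 1; rewrite scale1r mul1r.
have {Gne Gx0} Gx0 : G (x0, p x0) by case: Gne => u /Gx0.
have G00 : G (0, 0).
  have := Glin (-1) _ _ Gx0 Gx0.
  by rewrite /= scaleN1r addNr mulN1r addNr.
have Gtot y : exists r, G (y, r).
  have [c Gc] := dominated_graph_extend y pD pZ (conj Glin Gp) G00.
  exists c; apply: contrapT => nG; apply: (Gmax _ _ (conj Gc _)).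
  - split=> [u Gu|h].
      by exists u, 0; split => //; rewrite scale0r mul0r !addr0; case: u {Gu}.
    by apply: nG; apply: h; exists (0, 0), 1; rewrite /= scale1r mul1r !add0r.
  - move=> _ _; exists (x0, p x0), 0; split => //.
    by rewrite scale0r mul0r !addr0.
have GZ a u : G u -> G (a *: u.1, a * u.2).
  by move=> Gu; have := Glin a _ _ Gu G00; rewrite /= !addr0.
have Gfun x r s : G (x, r) -> G (x, s) -> r = s.
  move=> Gr Gs.
  have h1 := Gp _ (Glin (-1) _ _ Gr Gs).
  have h2 := Gp _ (Glin (-1) _ _ Gs Gr).
  move: h1 h2; rewrite /= scaleN1r addNr (seminorm0 pZ).
  by move=> h1 h2; apply/le_anti; lra.
have [l Gl] := choice Gtot.
have l_lin : linear (l : E -> R^o).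
  by move=> a x y; apply: (@Gfun (a *: x + y)) => //; exact: Glin (Gl x) (Gl y).
pose L : {linear E -> R^o} := HB.pack (l : E -> R^o)
  (GRing.isLinear.Build R E R^o *:%R l l_lin).
exists L; split; first exact: (@Gfun x0).
move=> x; rewrite ler_norml; apply/andP; split; last exact: (Gp (x, l x)).
have /= := Gp _ (GZ (-1) _ (Gl x)).
by rewrite scaleN1r (seminormN pZ) => h; change (- p x <= l x); lra.
Qed.

(** * Continuous seminorms of a locally convex space *)

Section continuous_seminorm_theory.
Variables (R : realType) (E : tvsType R).
Implicit Types (p q : E -> R) (U : set E).

Lemma nbhs_translate (x : E) U : nbhs x U -> nbhs (0 : E) [set h | U (x + h)].
Proof.
move=> /(nbhsB (- x)); rewrite addNr; apply: filterS => _ [y Uy <-] /=.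
by rewrite addrA subrr add0r.
Qed.

Lemma nbhs_untranslate (x : E) U :
  nbhs (0 : E) [set h | U (x + h)] -> nbhs x U.
Proof.
by move=> /(nbhsT x); apply: filterS => _ [h Uh <-].
Qed.

Lemma csn_ge0 q : continuous_seminorm q -> forall x, 0 <= q x.
Proof. by case=> qD qZ _; exact: seminorm_ge0. Qed.

Lemma csn0 q : continuous_seminorm q -> q 0 = 0.
Proof. by case=> _ qZ _; exact: seminorm0. Qed.

Lemma csnN q : continuous_seminorm q -> forall x, q (- x) = q x.
Proof. by case=> _ qZ _; exact: seminormN. Qed.

Lemma csnB q : continuous_seminorm q -> forall x y, q (x - y) = q (y - x).
Proof. by move=> hq x y; rewrite -(csnN hq) opprB. Qed.

Lemma csn_triangle q : continuous_seminorm q ->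
  forall x y z, q (x - z) <= q (x - y) + q (y - z).
Proof.
move=> [qD _ _] x y z; apply: le_trans (qD _ _).
by rewrite addrA subrK.
Qed.

Lemma csn_ball q (x : E) (e : R) : continuous_seminorm q -> 0 < e ->
  nbhs x [set y | q (y - x) < e].
Proof.
move=> hq e0; apply: nbhs_untranslate.
have [_ _ /(_ 0)] := hq; rewrite /continuous_at (csn0 hq) => h.
have h1 : nbhs (0 : E) [set y | q y < e] by exact: cvgr_lt h _ e0.
by apply: filterS h1 => y /=; rewrite addrAC subrr add0r.
Qed.

Lemma seminorm_continuous q :
  (forall x y, q (x + y) <= q x + q y) ->
  (forall (a : R) x, q (a *: x) = `|a| * q x) ->
  (forall e : R, 0 < e -> nbhs (0 : E) [set y | q y < e]) ->
  continuous_seminorm q.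
Proof.
move=> qD qZ q0; split=> // x; apply/cvgrPdist_lt => e e0.
apply: nbhs_untranslate; near=> h => /=.
have qh : q h < e by near: h; exact: q0.
have h1 := qD x h.
have h2 := qD (x + h) (- h).
rewrite addrK (seminormN qZ) in h2.
by rewrite ltr_norml; apply/andP; split; lra.
Unshelve. all: by end_near. Qed.

(** Local convexity in the form in which it is used: the seminorm is the gauge
    of a convex symmetric neighbourhood [S] of 0, which is absorbing because
    scaling is continuous. *)
Lemma csn_below_nbhs U : nbhs (0 : E) U ->
  exists q, continuous_seminorm q /\ forall x, q x < 1 -> U x.
Proof.
move=> U0; have [B Bconv [Bopen /(_ 0 _ U0)]] := @locally_convex R E.
rewrite /= => -[C [BC C0] CU].
have Cnbhs : nbhs (0 : E) C by exact: open_nbhs_nbhs (conj (Bopen _ BC) C0).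
have Cconv (x y : E) (t : R) : 0 <= t -> t <= 1 -> C x -> C y ->
    C (t *: x + (1 - t) *: y).
  move=> t0 t1 Cx Cy.
  pose l : {i01 R} := Itv01 t0 t1.
  have := Bconv C (mem_set BC) x y l (mem_set Cx) (mem_set Cy).
  by rewrite inE.
pose S : set E := [set x | C x /\ C (- x)].
have Snbhs : nbhs (0 : E) S.
  apply: filterI => //.
  have h : nbhs (0 : E) (-%R @` C) by exact: nbhs0N.
  apply: filterS h.
  by move=> _ [y Cy <-] /=; rewrite opprK.
have S0 : S 0 by exact: nbhs_singleton.
have Sconv (x y : E) (t : R) : 0 <= t -> t <= 1 -> S x -> S y ->
    S (t *: x + (1 - t) *: y).
  move=> t0 t1 [Cx CNx] [Cy CNy]; split; first exact: Cconv.
  by rewrite opprD -!scalerN; exact: Cconv.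
have SN x : S x -> S (- x) by move=> [? ?]; split; rewrite ?opprK.
pose T x : set R := [set r | 0 < r /\ S (r^-1 *: x)].
pose q x := inf (T x).
have Tlb x : lbound (T x) 0 by move=> r [/ltW].
have Tne x : T x !=set0.
  have : (fun t : R^o => t *: x) @ (0 : R^o) --> (0 : E).
    rewrite -[X in _ --> X](scale0r x).
    apply: (@continuous_comp R^o (R^o * E)%type E (fun t => (t, x))
      (fun z => z.1 *: z.2)); last exact: scale_continuous.
    by apply: (@cvg_pair _ _ _ (nbhs (0 : R^o)) (nbhs (0 : R^o)) (nbhs x));
      [exact: cvg_id|exact: cvg_cst].
  move=> /(_ S Snbhs); rewrite nbhs_simpl /= => /nbhs_ballP[e /= e0 eS].
  exists (e / 2)^-1; split; first by rewrite invr_gt0 divr_gt0.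
  rewrite invrK; apply: eS.
  by rewrite -ball_normE /= sub0r normrN gtr0_norm ?divr_gt0//; lra.
have q_le x r : 0 < r -> S (r^-1 *: x) -> q x <= r.
  by move=> r0 Sr; apply: ge_inf; [exists 0; exact: Tlb|].
have q0 x : 0 <= q x by apply: lb_le_inf => //; exact: Tlb.
have q_lt x r : q x < r -> S (r^-1 *: x).
  move=> qr; have [s [s0 Ss] sr] := inf_lt (Tne x) qr.
  have r0 : 0 < r by exact: lt_trans sr.
  have -> : r^-1 *: x = (s / r) *: (s^-1 *: x) + (1 - s / r) *: 0.
    by rewrite scaler0 addr0 scalerA mulrAC divff ?mul1r// gt_eqF.
  apply: Sconv => //; first by rewrite divr_ge0// ltW.
  by rewrite ler_pdivrMr// mul1r ltW.
have qD x y : q (x + y) <= q x + q y.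
  apply/ler_addgt0Pr => e e0.
  set r := q x + e / 2; set s := q y + e / 2.
  have r0 : 0 < r by rewrite /r; have := q0 x; lra.
  have s0 : 0 < s by rewrite /s; have := q0 y; lra.
  have -> : q x + q y + e = r + s by rewrite /r /s; lra.
  have rs0 : 0 < r + s by rewrite addr_gt0.
  apply: q_le => //.
  have -> : (r + s)^-1 *: (x + y) =
      (r / (r + s)) *: (r^-1 *: x) + (1 - r / (r + s)) *: (s^-1 *: y).
    rewrite !scalerA scalerDr; congr (_ *: _ + _ *: _).
      by rewrite mulrAC divff ?mul1r// gt_eqF.
    by field; rewrite !gt_eqF.
  apply: Sconv.
  - by rewrite divr_ge0// ltW.
  - by rewrite ler_pdivrMr// mul1r lerDl ltW.
  - by apply: q_lt; rewrite /r; lra.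
  - by apply: q_lt; rewrite /s; lra.
have qZle a x : q (a *: x) <= `|a| * q x.
  have [->|a0] := eqVneq a 0.
    rewrite scale0r normr0 mul0r; apply/ler_addgt0Pr => e e0.
    by rewrite add0r; apply: q_le => //; rewrite scaler0.
  apply/ler_addgt0Pr => e e0.
  have na0 : 0 < `|a| by rewrite normr_gt0.
  pose r := q x + e / `|a|.
  have qr : q x < r by rewrite /r ltrDl divr_gt0.
  have r0 : 0 < r by exact: le_lt_trans qr.
  have -> : `|a| * q x + e = `|a| * r.
    by rewrite /r mulrDr mulrCA divff ?mulr1// gt_eqF.
  apply: q_le; first by rewrite mulr_gt0.
  have Sr := q_lt _ _ qr.
  rewrite scalerA invfM.
  have [aneg|apos|a00] := ltgtP a 0; last by rewrite a00 eqxx in a0.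
    rewrite ltr0_norm// invrN.
    have -> : (- a^-1 / r * a) = - r^-1.
      by rewrite mulrAC mulNr mulVf// mulN1r.
    by rewrite scaleNr; exact: SN.
  by rewrite gtr0_norm// mulrAC mulVf// mul1r.
have qZ a x : q (a *: x) = `|a| * q x.
  apply/le_anti; rewrite qZle /=.
  have [->|a0] := eqVneq a 0; first by rewrite normr0 mul0r.
  have na0 : 0 < `|a| by rewrite normr_gt0.
  have := qZle a^-1 (a *: x).
  by rewrite scalerA mulVf// scale1r normrV ?unitfE// mulrC ler_pdivlMr// mulrC.
exists q; split.
- apply: seminorm_continuous => // e e0.
  have e20 : 0 < e / 2 by rewrite divr_gt0.
  have en : e / 2 != 0 by rewrite gt_eqF.
  have := nbhs0Z en Snbhs.
  apply: filterS => _ [y Sy <-] /=.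
  apply: (@le_lt_trans _ _ (e / 2)); last lra.
  by apply: q_le => //; rewrite scalerA mulVf// scale1r.
- by move=> x /q_lt; rewrite invr1 scale1r => -[/CU].
Qed.

Lemma nbhs_csnP (x : E) U : nbhs x U ->
  exists q, continuous_seminorm q /\ forall y, q (y - x) < 1 -> U y.
Proof.
move=> /nbhs_translate /csn_below_nbhs[q [hq qU]]; exists q; split => // y.
by move=> /qU /=; rewrite addrC subrK.
Qed.

Lemma csn_separates (x y : E) : hausdorff_space E ->
  (forall q, continuous_seminorm q -> q (x - y) = 0) -> x = y.
Proof.
move=> hE hx; apply: hE => A B Ax By.
have [q [hq qB]] := nbhs_csnP By.
exists x; split; first exact: nbhs_singleton.
by apply: qB; rewrite hx.
Qed.

Lemma linear_dominated_continuous q (l : {linear E -> R^o}) :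
  continuous_seminorm q -> (forall x, `|l x| <= q x) -> continuous l.
Proof.
move=> hq lq x; apply/cvgrPdist_lt => e e0.
have := csn_ball x hq e0; apply: filterS => y /= qy.
by rewrite -linearB /=; apply: le_lt_trans (lq _) _; rewrite (csnB hq).
Qed.

(** A functional that norms [x]: it turns estimates for all functionals bounded
    by [q], such as those for weak integrals, into estimates for [q]. *)
Lemma csn_dual q (x : E) : continuous_seminorm q ->
  exists l : {linear E -> R^o},
    [/\ continuous l, l x = q x & forall y, `|l y| <= q y].
Proof.
move=> hq; have [qD qZ _] := hq.
have [l [lx lq]] := hahn_banach x qD qZ; exists l; split => //.
exact: linear_dominated_continuous lq.
Qed.

End continuous_seminorm_theory.

Lemma csn_comp (R : realType) (E F : tvsType R) (g : {linear E -> F})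
    (q : F -> R) :
  continuous g -> continuous_seminorm q -> continuous_seminorm (q \o g).
Proof.
move=> gc [qD qZ qc]; split.
- by move=> x y /=; rewrite linearD.
- by move=> a x /=; rewrite linearZ /= qZ.
- by move=> x; apply: continuous_comp; [exact: gc|exact: qc].
Qed.

(** * Directional derivatives and seminorms *)

Lemma cvg_csnP (R : realType) (E : tvsType R) (T : Type) (F : set_system T)
    (FF : Filter F) (g : T -> E) (w : E) :
  (g @ F --> w) <->
  (forall q, continuous_seminorm q -> forall e : R, 0 < e ->
    F [set h | q (g h - w) < e]).
Proof.
split=> [gw q hq e e0|h U /nbhs_csnP[q [hq qU]]].
  exact: (gw _ (csn_ball w hq e0)).
have {}h : F [set z | q (g z - w) < 1] by exact: h.
by apply: (@filterS _ F _ _ _ _ h) => x /= /qU.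
Qed.

Lemma quotient_cvgP (R : realType) (E : tvsType R) (D : set R) (g : R -> E)
    (w : E) :
  (h^-1 *: g h @[h --> within D (0 : R)^'] --> w) <->
  (forall q, continuous_seminorm q -> forall e : R, 0 < e ->
    exists2 d : R, 0 < d & forall h, h != 0 -> `|h| < d -> D h ->
      q (g h - h *: w) <= e * `|h|).
Proof.
have key q (h : R) : continuous_seminorm q -> h != 0 ->
    q (g h - h *: w) = `|h| * q (h^-1 *: g h - w).
  move=> [_ qZ _] h0; rewrite -qZ scalerBr scalerA divff// scale1r.
  by [].
split.
- move=> /cvg_csnP gw q hq e e0; have := gw _ hq _ e0.
  rewrite /within /dnbhs /= => -[d /= d0 dP]; exists d => // h h0 hd Dh.
  rewrite key// mulrC ler_wpM2r//; apply/ltW.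
  apply: (dP h) => //=.
  by rewrite sub0r normrN.
- move=> gw; apply/cvg_csnP => q hq e e0.
  have e2 : 0 < e / 2 by rewrite divr_gt0.
  have [d d0 dP] := gw q hq _ e2.
  exists d => //= h /=; rewrite sub0r normrN => hd h0 Dh /=.
  have := dP h h0 hd Dh; rewrite key// mulrC ler_pM2r ?normr_gt0//; lra.
Qed.

Lemma has_dirderivP (R : realType) (E F : tvsType R) (f : E -> F) (x y : E)
    (w : F) :
  has_dirderiv f x y w <->
  (forall q, continuous_seminorm q -> forall e : R, 0 < e ->
    exists2 d : R, 0 < d & forall h, h != 0 -> `|h| < d ->
      q (f (x + h *: y) - f x - h *: w) <= e * `|h|).
Proof.
rewrite /has_dirderiv.
have -> : (0 : R)^' = within setT (0 : R)^'.
  apply/seteqP; split=> A; rewrite /within /= => h; last first.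
    by apply: filterS h => z; exact.
  by apply: filterS h.
split=> [/quotient_cvgP|] H.
  by move=> q hq e e0; have [d d0 dP] := H q hq e e0; exists d => // h *; exact: dP.
apply/quotient_cvgP.
by move=> q hq e e0; have [d d0 dP] := H q hq e e0; exists d => // h *; exact: dP.
Qed.

Lemma has_deriv_inP (R : realType) (E : tvsType R) (I : set R) (g : R -> E)
    (t : R) (v : E) :
  has_deriv_in I g t v <->
  (forall q, continuous_seminorm q -> forall e : R, 0 < e ->
    exists2 d : R, 0 < d & forall h, h != 0 -> `|h| < d -> I (t + h) ->
      q (g (t + h) - g t - h *: v) <= e * `|h|).
Proof. exact: quotient_cvgP. Qed.

Lemma has_dirderivZ (R : realType) (E F : tvsType R) (f : E -> F) (x y : E)
    (w : F) (a : R) : a != 0 ->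
  has_dirderiv f x y w -> has_dirderiv f x (a *: y) (a *: w).
Proof.
move=> a0 /has_dirderivP H; apply/has_dirderivP => q hq e e0.
have na : 0 < `|a| by rewrite normr_gt0.
have ea : 0 < e / `|a| by rewrite divr_gt0.
have [d d0 dP] := H q hq _ ea.
exists (d / `|a|); first by rewrite divr_gt0.
move=> h h0; rewrite ltr_pdivlMr// -normrM => hd.
have := dP (h * a) _ hd; rewrite mulf_neq0// => /(_ isT).
rewrite -!scalerA normrM.
by have -> : e / `|a| * (`|h| * `|a|) = e * `|h| by field; rewrite gt_eqF.
Qed.

(** Limits are unique up to the kernel of each continuous seminorm. *)
Lemma has_dirderiv_csn_eq (R : realType) (E F : tvsType R) (f : E -> F)
    (x y : E) (w w' : F) (q : F -> R) : continuous_seminorm q ->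
  has_dirderiv f x y w -> has_dirderiv f x y w' -> q (w - w') = 0.
Proof.
move=> hq /has_dirderivP H /has_dirderivP H'.
apply/le_anti; rewrite (csn_ge0 hq) andbT; apply/ler_addgt0Pr => e e0.
rewrite add0r.
have e2 : 0 < e / 2 by rewrite divr_gt0.
have [d d0 dP] := H q hq _ e2.
have [d' d'0 dP'] := H' q hq _ e2.
have [h h0 [hd hd']] : exists2 h : R, 0 < h & h < d /\ h < d'.
  have m0 : 0 < Num.min d d' by rewrite lt_min d0.
  exists (Num.min d d' / 2); first by rewrite divr_gt0.
  by apply/andP; rewrite -lt_min gtr_pMr// invf_lt1// ltr1n.
have := dP h; rewrite gt_eqF// gtr0_norm// => /(_ isT hd) k1.
have := dP' h; rewrite gt_eqF// gtr0_norm// => /(_ isT hd') k2.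
have [_ qZ _] := hq.
have : h * q (w - w') <= h * e.
  have -> : h * q (w - w') = q (h *: w - h *: w').
    by rewrite -scalerBr qZ gtr0_norm.
  have := csn_triangle hq (h *: w) (f (x + h *: y) - f x) (h *: w').
  by rewrite (csnB hq (h *: w) (f _ - _)); lra.
by rewrite ler_pM2l.
Qed.

Lemma has_dirderiv0_csn (R : realType) (E F : tvsType R) (f : E -> F)
    (x : E) (w : F) (q : F -> R) : continuous_seminorm q ->
  has_dirderiv f x 0 w -> q w = 0.
Proof.
move=> hq hw; rewrite -(subr0 w); apply: (has_dirderiv_csn_eq hq hw).
apply/has_dirderivP => r hr e e0; exists 1 => // h _ _.
by rewrite !scaler0 addr0 subrr subr0 (csn0 hr) mulr_ge0// ltW.
Qed.

Lemma csn_ball_convex (R : realType) (E : tvsType R) (r : E -> R)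
    (x0 x x' : E) (c : R) : continuous_seminorm r ->
  0 <= c <= 1 -> r (x - x0) < 1 -> r (x' - x0) < 1 ->
  r (x' + c *: (x - x') - x0) < 1.
Proof.
move=> [rD rZ _] /andP[c0 c1] rx rx'.
have -> : x' + c *: (x - x') - x0 = (1 - c) *: (x' - x0) + c *: (x - x0).
  have -> : x - x' = (x - x0) - (x' - x0) by rewrite opprB addrA subrK.
  by rewrite addrAC scalerBr scalerBl scale1r addrA addrAC.
apply: le_lt_trans (rD _ _) _; rewrite !rZ !ger0_norm ?subr_ge0//.
have [->|cn] := eqVneq c 0; first by rewrite mul0r subr0 mul1r addr0.
have cp : 0 < c by rewrite lt_neqAle eq_sym cn.
have : c * r (x - x0) < c by rewrite -{2}(mulr1 c) ltr_pM2l.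
have : (1 - c) * r (x' - x0) <= 1 - c.
  by rewrite -{2}(mulr1 (1 - c)) ler_wpM2l ?subr_ge0// ltW.
by lra.
Qed.

(** * Local Lipschitz estimates for C1 maps and the chain rule *)

Lemma has_dirderiv_is_derive (R : realType) (E F : tvsType R) (f : E -> F)
    (l : {linear F -> R^o}) (x y : E) (w : F) (c : R) :
  continuous l -> has_dirderiv f (x + c *: y) y w ->
  is_derive c 1 (fun t : R => l (f (x + t *: y)) : R) (l w).
Proof.
move=> lc hw.
have lw := continuous_cvg _ (lc w) hw.
suff H : h^-1 *: (((fun t : R => l (f (x + t *: y)) : R) \o shift c)
    (h *: (1 : R)) - l (f (x + c *: y))) @[h --> (0 : R)^'] --> (l w : R).
  split; first by apply/cvg_ex; exists (l w).
  exact: cvg_lim.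
rewrite [X in fmap X](_ : _ = fun h =>
  l (h^-1 *: (f (x + c *: y + h *: y) - f (x + c *: y))) : R).
  exact: lw.
apply/funext => h /=.
have -> : x + (h *: (1 : R) + c) *: y = x + c *: y + h *: y.
  by rewrite -addrA -scalerDl [h *: 1]mulr1 (addrC h).
by rewrite [RHS]linearZ (linearB l).
Qed.

(** A C1 map is locally Lipschitz for suitable seminorms: near [(x0, 0)] the
    derivative stays below 1 for [p], homogeneity in the direction turns this
    into a bound by a seminorm [q], and the mean value theorem applies to the
    composition with a functional that norms the increment for [p]. *)
Lemma C1_on_lipschitz (R : realType) (E F : tvsType R) (U : set E)
    (f : E -> F) (x0 : E) (p : F -> R) :
  open U -> U x0 -> C1_on U f -> continuous_seminorm p ->
  exists q r, [/\ continuous_seminorm q, continuous_seminorm r &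
    forall x x', r (x - x0) < 1 -> r (x' - x0) < 1 ->
      U x /\ p (f x - f x') <= q (x - x')].
Proof.
move=> oU Ux0 [_ [df hdf /subspace_continuousP cdf]] hp.
have hp0 : p (df (x0, 0)) = 0.
  by apply: (has_dirderiv0_csn hp) (hdf x0 0 Ux0).
(* [df (x0, 0)] is annihilated by [p], so [p (df z)] stays below 1 near
   [(x0, 0)]. *)
have small : nbhs (df (x0, 0)) [set v | p v < 1].
  have [_ _ pc] := hp.
  by apply: (cvgr_lt (p (df (x0, 0))) (pc _)); rewrite hp0.
have := cdf (x0, 0) (conj Ux0 I) _ small.
rewrite nbhs_simpl /within /= => -[[A1 A2] /= [nA1 nA2] A12].
have nU : nbhs x0 (A1 `&` U) by apply: filterI => //; exact: open_nbhs_nbhs.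
have [r [hr rA]] := nbhs_csnP nU.
have [q [hq qA]] := nbhs_csnP nA2.
exists q, r; split=> // x x' rx rx'.
split; first by have [] := rA _ rx.
(* The functional depends on the increment, the bounds on [df] do not. *)
have [l [lc lw lp]] := csn_dual (f x - f x') hp.
rewrite -lw; apply/ler_addgt0Pr => e e0.
set rho := q (x - x') + e.
have rho0 : 0 < rho by rewrite /rho; have := csn_ge0 hq (x - x'); lra.
have inA (c : R) : 0 <= c <= 1 -> (A1 `&` U) (x' + c *: (x - x')).
  by move=> c01; apply: rA; exact: csn_ball_convex.
have dbound (c : R) : 0 <= c <= 1 -> p (df (x' + c *: (x - x'), x - x')) <= rho.
  move=> c01; have [A1c Uc] := inA c c01.
  set z := x' + _ in A1c Uc *.
  have [_ pZ _] := hp.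
  have small' : p (df (z, rho^-1 *: (x - x'))) < 1.
    apply: (A12 (z, rho^-1 *: (x - x'))) => //; split => //=.
    apply: qA; have [_ qZ _] := hq.
    rewrite subr0 qZ gtr0_norm ?invr_gt0// ltr_pdivrMl// mulr1.
    by rewrite /rho; lra.
  have h1 := hdf z (rho^-1 *: (x - x')) Uc.
  have h2 := has_dirderivZ (invr_neq0 (lt0r_neq0 rho0)) (hdf z (x - x') Uc).
  have := has_dirderiv_csn_eq hp h2 h1.
  have [pD _ _] := hp.
  have := pD (rho^-1 *: df (z, x - x') - df (z, rho^-1 *: (x - x')))
             (df (z, rho^-1 *: (x - x'))).
  rewrite subrK pZ gtr0_norm ?invr_gt0// => k1 k2.
  have : rho^-1 * p (df (z, x - x')) <= 1 by lra.
  by rewrite ler_pdivrMl// mulr1.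
pose g (t : R) : R := l (f (x' + t *: (x - x'))).
pose dg (t : R) : R := l (df (x' + t *: (x - x'), x - x')).
have g_deriv (c : R) : 0 <= c <= 1 -> is_derive c 1 g (dg c).
  move=> c01; apply: has_dirderiv_is_derive => //.
  by apply: hdf; have [] := inA c c01.
have g_cont : {within `[0, 1], continuous g}.
  apply: derivable_within_continuous => c; rewrite in_itv /= => c01.
  by have [] := g_deriv c c01.
have [c] := MVT_segment (@ler01 R) (fun c h => g_deriv c (subset_itv_oo_cc h)) g_cont.
rewrite in_itv /= => c01.
rewrite /g scale0r addr0 scale1r subrKC subr0 mulr1 => gE.
rewrite linearB /= gE.
exact: le_trans (ler_norm _) (le_trans (lp _) (dbound c c01)).
Qed.

Lemma has_deriv_in_continuous (R : realType) (E : tvsType R) (I : set R)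
    (b : R -> E) (t : R) (v : E) (q : E -> R) (e : R) :
  has_deriv_in I b t v -> continuous_seminorm q -> 0 < e ->
  exists2 d : R, 0 < d & forall h, `|h| < d -> I (t + h) ->
    q (b (t + h) - b t) < e /\ q (h *: v) < e.
Proof.
move=> /has_deriv_inP H hq e0.
have [d d0 dP] := H q hq 1 ltr01.
have [qD qZ _] := hq.
have K0 : 0 < 1 + q v by have := csn_ge0 hq v; lra.
exists (Num.min d (e / (1 + q v))); first by rewrite lt_min d0 divr_gt0.
move=> h; rewrite lt_min => /andP[hd]; rewrite ltr_pdivlMr// => he Ih.
have hv : q (h *: v) < e.
  by rewrite qZ; apply: le_lt_trans he; rewrite ler_wpM2l//; lra.
split=> //; have [->|h0] := eqVneq h 0.
  by rewrite addr0 subrr (csn0 hq).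
have := dP h h0 hd Ih.
have := qD (b (t + h) - b t - h *: v) (h *: v).
by rewrite subrK qZ; rewrite mulrDr mulr1 in he; lra.
Qed.

(** The Lipschitz estimate compares [f (b (t + h))] with [f (b t + h v)], and
    along the line [b t + h v] the directional derivative applies. *)
Lemma has_deriv_in_comp (R : realType) (E F : tvsType R) (U : set E)
    (f : E -> F) (I : set R) (b : R -> E) (t : R) (v : E) (w : F) :
  open U -> U (b t) -> C1_on U f ->
  has_deriv_in I b t v -> has_dirderiv f (b t) v w ->
  has_deriv_in I (f \o b) t w.
Proof.
move=> oU Ub fC1 bv /has_dirderivP fw; apply/has_deriv_inP => p hp e e0.
have [q [r [hq hr fL]]] := C1_on_lipschitz oU Ub fC1 hp.
have e2 : 0 < e / 2 by rewrite divr_gt0.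
have [d1 d10 d1P] := has_deriv_in_continuous bv hr ltr01.
have [d2 d20 d2P] := (has_deriv_inP _ _ _ _).1 bv q hq _ e2.
have [d3 d30 d3P] := fw p hp _ e2.
exists (Num.min d1 (Num.min d2 d3)); first by rewrite !lt_min d10 d20.
move=> h h0; rewrite !lt_min => /and3P[hd1 hd2 hd3] Ih.
have [r1 r2] := d1P h hd1 Ih.
have := d2P h h0 hd2 Ih; have := d3P h h0 hd3.
have r2' : r (b t + h *: v - b t) < 1 by rewrite addrAC subrr add0r.
have [_] := fL _ _ r1 r2'.
have -> : b (t + h) - (b t + h *: v) = b (t + h) - b t - h *: v.
  by rewrite opprD addrA.
have [pD _ _] := hp.
have := pD (f (b (t + h)) - f (b t + h *: v)) (f (b t + h *: v) - f (b t) - h *: w).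
have -> : f (b (t + h)) - f (b t + h *: v) + (f (b t + h *: v) - f (b t) - h *: w)
    = f (b (t + h)) - f (b t) - h *: w by rewrite !addrA subrK.
rewrite /=; lra.
Qed.

(** * Curves with almost everywhere vanishing derivative *)

(** The supremum of the points up to which the inequality has been reached
    belongs to this set and cannot lie below [b]. *)
Lemma local_to_global (R : realType) (D : R -> R -> R) (m : R -> R) (a b : R) :
  a <= b -> (forall x y z, D x z <= D x y + D y z) ->
  (forall s, a <= s <= b -> exists2 d : R, 0 < d &
    forall t, a <= t <= b -> `|t - s| < d ->
      (s <= t -> D s t <= m t - m s) /\ (t <= s -> D t s <= m s - m t)) ->
  D a b <= m b - m a.
Proof.
move=> ab DD loc.
pose S : set R := [set s | a <= s <= b /\ D a s <= m s - m a].
have Sa : S a.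
  have aab : a <= a <= b by rewrite lexx.
  have [d d0 /(_ a aab)] := loc a aab.
  by rewrite subrr normr0 => /(_ d0)[/(_ (lexx _)) ? _].
have Sub : ubound S b by move=> s [/andP[]].
have Shs : has_sup S by split; [exists a|exists b].
pose s := sup S.
have as_ : a <= s by apply: ub_le_sup => //; exists b.
have sb : s <= b by apply: ge_sup => //; exists a.
have sab : a <= s <= b by rewrite as_.
have [d d0 dP] := loc s sab.
have Ss : S s.
  split => //; have [r Sr sr] := sup_adherent d0 Shs.
  have rs : r <= s by apply: ub_le_sup => //; exists b.
  have [rab Dr] := Sr.
  have rd : `|r - s| < d.
    by rewrite distrC ger0_norm ?subr_ge0//; rewrite -/s in sr; lra.
  have [_ /(_ rs)] := dP r rab rd.
  by have := DD a r s; lra.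
have [sltb|bs] := ltP s b; last first.
  by have -> : b = s; [apply/le_anti; rewrite bs|case: Ss].
pose t := Num.min b (s + d / 2).
have st : s < t by rewrite /t lt_min sltb; lra.
have tb : t <= b by rewrite /t ge_min lexx.
have td : t <= s + d / 2 by rewrite /t ge_min lexx orbT.
have tab : a <= t <= b by rewrite tb andbT (le_trans as_)// ltW.
have tsd : `|t - s| < d by rewrite ger0_norm ?subr_ge0 ?ltW//; lra.
have [/(_ (ltW st)) h _] := dP t tab tsd.
have St : S t by split => //; have := DD a s t; case: Ss => _; lra.
have : t <= s by apply: ub_le_sup => //; exists b.
by rewrite leNgt st.
Qed.

Section lebesgue.
Variable R : realType.
Notation mu := (@lebesgue_measure R).
Implicit Types (a b s t : R).

Lemma Rintegral_itv_sub (f : R -> R) a b s t :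
  mu.-integrable `[a, b] (EFin \o f) -> a <= s -> s <= t -> t <= b ->
  \int[mu]_(x in `]s, t]) f x =
    \int[mu]_(x in `[a, t]) f x - \int[mu]_(x in `[a, s]) f x.
Proof.
move=> fi as_ st tb; rewrite -(@Rintegral_itvB _ f (BLeft a) (BRight t) s)//.
apply: integrableS fi => //; apply: subset_itvl.
by rewrite bnd_simp.
Qed.

(** The hypotheses are those of an absolutely continuous curve with derivative
    zero off the null set [Z].  This set lies in an open set [G] on which the
    integral of [rho] is at most [e].  Around a point of [G] the integral bound
    is used, around any other point the bound by the derivative; in both cases
    the increment of [D] is at most that of the function [m] below, which grows
    by at most [e + e (b - a)]. *)
Lemma null_derivative_increment (D : R -> R -> R) (rho : R -> R) a b (Z : set R) :
  a <= b -> (forall x y, D x y = D y x) ->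
  (forall x y z, D x z <= D x y + D y z) ->
  (forall x, 0 <= rho x) -> mu.-integrable `[a, b] (EFin \o rho) ->
  (forall s t, a <= s -> s <= t -> t <= b ->
    D s t <= \int[mu]_(x in `]s, t]) rho x) ->
  mu.-negligible Z ->
  (forall s, a <= s <= b -> ~ Z s -> forall e : R, 0 < e ->
    exists2 d : R, 0 < d & forall t, a <= t <= b -> `|t - s| < d ->
      D s t <= e * `|t - s|) ->
  D a b <= 0.
Proof.
move=> ab Dsym DD rho0 rhoi Drho [N [mN N0 ZN]] Dder.
have mab : measurable (`[a, b]%classic : set (measurableTypeR R)).
  exact: measurable_itv.
suff main (e : R) : 0 < e -> D a b <= e + e * (b - a).
  have K0 : 0 < 1 + (b - a) by lra.
  apply/ler_addgt0Pr => e e0; rewrite add0r.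
  have := main (e / (1 + (b - a))) (divr_gt0 e0 K0).
  suff -> : e / (1 + (b - a)) + e / (1 + (b - a)) * (b - a) = e by [].
  by field; rewrite gt_eqF.
move=> e0.
pose f : R -> R := rho \_ `[a, b].
have fi : mu.-integrable setT (EFin \o f).
  by rewrite /f -restrict_EFin; apply/(integrable_mkcond _ mab).
have [d [d0 dP]] := integral_normr_continuous fi e0.
have N_fin : (mu N < +oo)%E by rewrite N0 ltry.
have [G [oG NG Gd]] := lebesgue_regularity_outer mN N_fin d0.
have mG : measurable (G : set (measurableTypeR R)) by exact: open_measurable.
have muG : (mu G < d%:E)%E.
  apply: le_lt_trans Gd.
  have h : (mu G <= mu N + mu (G `\` N))%E.
    have := measureU2 (mu : {measure set _ -> \bar R}) mN (measurableD mG mN).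
    by rewrite (setDUK NG).
  by apply: le_trans h _; rewrite N0 add0e.
have := dP G mG muG => {dP}.
have -> : \int[mu]_(x in G) `|f x| = \int[mu]_(x in `[a, b]) (rho \_ G) x.
  rewrite -Rintegral_mkcondr setIC Rintegral_mkcondr.
  apply: eq_Rintegral => x _; rewrite ger0_norm// /f patchE.
  by case: ifPn.
move=> IG.
have rGi : mu.-integrable `[a, b] (EFin \o (rho \_ G)).
  rewrite -restrict_EFin; apply/(integrable_restrict _ mG mab).
  by apply: integrableS rhoi => //; exact: measurableI.
pose m s := \int[mu]_(x in `[a, s]) (rho \_ G) x + e * (s - a).
have rG0 x : 0 <= (rho \_ G) x by rewrite patchE; case: ifPn.
have msub s t : a <= s -> s <= t -> t <= b -> m t - m s =
    \int[mu]_(x in `]s, t]) (rho \_ G) x + e * (t - s).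
  move=> as_ st tb; rewrite (Rintegral_itv_sub rGi as_ st tb) /m; ring.
have ma : 0 <= m a.
  by rewrite /m subrr mulr0 addr0; apply: Rintegral_ge0.
have mb : m b <= e + e * (b - a) by rewrite /m lerD2r ltW.
suff : D a b <= m b - m a.
  by move=> /le_trans; apply; rewrite lerBlDr (le_trans mb)// lerDl.
apply: local_to_global => // s /andP[as_ sb].
have [Gs|nGs] := pselect (G s).
  have /nbhs_ballP[r /= r0 rG] : nbhs s G by exact: open_nbhs_nbhs.
  have inG t u : a <= t -> t <= u -> u <= b -> (forall x, t <= x <= u -> G x) ->
      D t u <= m u - m t.
    move=> at_ tu ub tuG; rewrite msub//.
    apply: le_trans (Drho t u at_ tu ub) _.
    have -> : \int[mu]_(x in `]t, u]) rho x =
        \int[mu]_(x in `]t, u]) (rho \_ G) x.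
      apply: eq_Rintegral => x; rewrite inE /= in_itv /= => /andP[tx xu].
      by rewrite patchE mem_set//; apply: tuG; rewrite xu ltW.
    by rewrite lerDl mulr_ge0 ?subr_ge0// ltW.
  exists r => // t /andP[at_ tb] tsr; split=> [st|ts]; apply: inG => //.
    move=> x /andP[sx xt]; apply: rG; rewrite -ball_normE /=.
    rewrite distrC ger0_norm ?subr_ge0//; apply: le_lt_trans tsr.
    by rewrite ger0_norm ?subr_ge0// lerD2r.
  move=> x /andP[tx xs]; apply: rG; rewrite -ball_normE /=.
  rewrite ger0_norm ?subr_ge0//; apply: le_lt_trans tsr.
  by rewrite distrC ger0_norm ?subr_ge0// lerD2l lerN2.
have nZs : ~ Z s by move=> /ZN/NG.
have sab : a <= s <= b by rewrite as_.
have [r r0 rP] := Dder s sab nZs e e0.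
exists r => // t tab tsr; have Dst := rP t tab tsr.
have /andP[at_ tb] := tab.
have ge0 x y : 0 <= \int[mu]_(z in `]x, y]) (rho \_ G) z.
  exact: Rintegral_ge0.
split=> [st|ts]; rewrite msub//.
  rewrite ger0_norm ?subr_ge0// in Dst.
  by rewrite (le_trans Dst)// lerDr.
rewrite Dsym distrC ger0_norm ?subr_ge0// in Dst.
by rewrite (le_trans Dst)// lerDr.
Qed.

Variable E : tvsType R.

Lemma L1_path_measurable a b (g : R -> E) (q : E -> R) :
  L1_path a b g -> continuous q -> measurable_fun `[a, b] (q \o g).
Proof.
move=> [gm _ _] qc mD; apply: (measurability _ (RGenOpens.measurableE R)) => //.
move=> _ [_ [x [y ->] <-]]; rewrite comp_preimage; apply: gm.
apply: sub_sigma_algebra.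
by apply: open_comp => [z _|]; [exact: qc|exact: interval_open].
Qed.

Lemma L1_path_integrable a b (g : R -> E) (q : E -> R) :
  L1_path a b g -> continuous_seminorm q ->
  mu.-integrable `[a, b] (EFin \o (q \o g)).
Proof.
move=> gL hq; have [_ _ gi] := gL; have [_ _ qc] := hq.
apply/integrableP; split.
  by apply/measurable_EFinP; exact: L1_path_measurable.
apply: le_lt_trans (gi q hq); rewrite le_eqVlt; apply/orP; left.
by apply/eqP/eq_integral => x _ /=; rewrite ger0_norm// (csn_ge0 hq).
Qed.

(** The weak integral is tested against a functional that norms the increment
    [eta t - eta s] for [q]. *)
Lemma weak_integral_csn_le a b (g eta : R -> E) (q : E -> R) :
  L1_path a b g ->
  (forall t, a <= t <= b -> is_weak_integral a t g (eta t - eta a)) ->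
  continuous_seminorm q ->
  forall s t, a <= s -> s <= t -> t <= b ->
    q (eta t - eta s) <= \int[mu]_(x in `]s, t]) q (g x).
Proof.
move=> gL gw hq s t as_ st tb.
have [l [lc lq lle]] := csn_dual (eta t - eta s) hq.
have qi := L1_path_integrable gL hq.
have li : mu.-integrable `[a, b] (EFin \o (l \o g)).
  apply: le_integrable qi => //.
    by apply/measurable_EFinP; exact: L1_path_measurable.
  move=> x _; rewrite lee_fin.
  by apply: le_trans (lle _) _; exact: ler_norm.
have lint u : a <= u <= b -> l (eta u - eta a) = \int[mu]_(x in `[a, u]) l (g x).
  by move=> aub; rewrite /Rintegral -(gw u aub l lc).
have stb : (`]s, t] `<=` `[a, b])%classic.
  by apply: subset_itv; rewrite bnd_simp.
rewrite -lq.
have -> : eta t - eta s = (eta t - eta a) - (eta s - eta a).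
  by rewrite opprB addrA subrK.
rewrite linearB /= !lint ?as_ ?tb ?(le_trans as_ st) ?(le_trans st tb)//.
rewrite -[X in X <= _](Rintegral_itv_sub li as_ st tb).
apply: le_Rintegral => //.
- exact: integrableS li.
- exact: integrableS qi.
- by move=> x _; apply: le_trans (lle _); exact: ler_norm.
Qed.

End lebesgue.

(** * Charts and velocities *)

Lemma open_nbhsW (T : topologicalType) (A : set T) (x : T) :
  open A -> A x -> nbhs x A.
Proof. by move=> oA Ax; exact: open_nbhs_nbhs. Qed.

Lemma open_preimage_within (X Y : topologicalType) (A : set X) (B : set Y)
    (f : X -> Y) :
  open A -> open B -> {within A, continuous f} -> open (A `&` f @^-1` B).
Proof.
move=> oA oB /subspace_continuousP fc; rewrite openE => x [Ax Bx].
have nB : nbhs (f x) B by exact: open_nbhs_nbhs.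
have nA : nbhs x A by exact: open_nbhs_nbhs.
have := fc x Ax _ nB; rewrite nbhs_simpl /within /= => h.
by apply: filterS (filterI nA h) => z [Az /(_ Az)].
Qed.

Lemma within_continuous_ball (R : realType) (Y : topologicalType) (I : set R)
    (g : R -> Y) (t : R) (B : set Y) :
  {within I, continuous g} -> I t -> nbhs (g t) B ->
  exists2 d : R, 0 < d & forall s, I s -> `|s - t| < d -> B (g s).
Proof.
move=> /subspace_continuousP gc It nB.
have := gc t It _ nB; rewrite nbhs_simpl /within /= => -[d /= d0 dP].
exists d => // s Is sd; apply: dP => //=.
by rewrite distrC.
Qed.

Lemma within_nbhs_ball (R : realType) (I B : set R) (t : R) :
  within I (nbhs t) B ->
  exists2 d : R, 0 < d & forall s, I s -> `|s - t| < d -> B s.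
Proof.
rewrite /within /= => -[d /= d0 dP].
exists d => // s Is sd; apply: dP => //=.
by rewrite distrC.
Qed.

Section charts.
Variables (R : realType).

Lemma chart_image_open (M : topologicalType) (E : tvsType R) (c : chart M E)
    (B : set M) : open B -> open (c @` (cdom c `&` B)).
Proof.
move=> oB.
have -> : c @` (cdom c `&` B) = ccod c `&` cinv c @^-1` B.
  apply/seteqP; split=> [_ [y [cy By] <-]|v [cv Bv]].
    by split; [exact: cfun_cod|rewrite /= cfunK].
  by exists (cinv c v); [split => //; exact: cinv_dom|rewrite cinvK].
by apply: open_preimage_within; [exact: ccod_open| |exact: cinv_continuous].
Qed.

Lemma chart_nbhs (M : topologicalType) (E : tvsType R) (c : chart M E)
    (y : M) (A : set E) : cdom c y -> nbhs (c y) A ->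
  nbhs y (cdom c `&` c @^-1` A).
Proof.
move=> cy nA.
have nc : nbhs y (cdom c) by apply: open_nbhs_nbhs; split => //; exact: cdom_open.
have /subspace_continuousP h := @cfun_continuous _ _ _ c.
have := h y cy _ nA; rewrite nbhs_simpl /within /= => {}h.
by apply: filterS (filterI nc h) => z [cz /(_ cz)].
Qed.

Lemma atlas_is_chart (E : tvsType R) (M : C1manifold E) (c : chart M E) :
  atlas c -> is_chart c.
Proof. by move=> ac c' ac'; exact: atlas_compatible. Qed.

Lemma prod_is_chart (E1 E2 : tvsType R) (M1 : C1manifold E1)
    (M2 : C1manifold E2) (c1 : chart M1 E1) (c2 : chart M2 E2) :
  is_chart c1 -> is_chart c2 ->
  is_chart (M := prod_manifold M1 M2) (prod_chart c1 c2).
Proof.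
move=> h1 h2 _ [c1' [c2' [a1 a2 ->]]].
have [h1l h1r] := h1 c1' a1; have [h2l h2r] := h2 c2' a2.
by split; exact: C1_transition_prod.
Qed.

(** Velocities are compared in a chart of the atlas since two arbitrary charts
    are only known to be compatible with the charts of the atlas. *)
Lemma has_velocity_atlas (E : tvsType R) (M : C1manifold E) (I : set R)
    (eta : R -> M) (t : R) (c a : chart M E) (v w : E) :
  {within I, continuous eta} -> I t -> is_chart c -> atlas a ->
  cdom c (eta t) -> cdom a (eta t) ->
  has_deriv_in I (c \o eta) t v ->
  has_dirderiv (a \o cinv c) (c (eta t)) v w ->
  has_deriv_in I (a \o eta) t w.
Proof.
move=> etac It hc ha cy ay etav aw.
have [tr _] := hc a ha.
have oU : open (c @` (cdom c `&` cdom a)) by apply: chart_image_open; exact: cdom_open.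
have Uy : (c @` (cdom c `&` cdom a)) ((c \o eta) t) by exists (eta t).
have /has_deriv_inP H := has_deriv_in_comp oU Uy tr etav aw.
have nc : nbhs (eta t) (cdom c).
  by apply: open_nbhs_nbhs; split => //; exact: cdom_open.
have [d d0 dP] := within_continuous_ball etac It nc.
apply/has_deriv_inP => q hq e e0; have [d' d'0 d'P] := H q hq e e0.
exists (Num.min d d'); first by rewrite lt_min d0.
move=> h h0; rewrite lt_min => /andP[hd hd'] Ih.
have := d'P h h0 hd' Ih; rewrite /= !cfunK//.
by apply: dP => //; rewrite addrAC subrr add0r.
Qed.

(** In a chart of the atlas, the two curves have the common derivative prescribed
    by the tangent vector. *)
Lemma equal_velocity (E : tvsType R) (M : C1manifold E) (I1 I2 : set R)
    (eta1 eta2 : R -> M) (t : R) (X : tangent_bundle M) :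
  {within I1, continuous eta1} -> {within I2, continuous eta2} ->
  I1 t -> I2 t -> eta1 t = eta2 t ->
  has_velocity I1 eta1 t X -> has_velocity I2 eta2 t X ->
  exists (a : chart M E) (w : E),
    [/\ atlas a, cdom a (eta1 t), has_deriv_in I1 (a \o eta1) t w
      & has_deriv_in I2 (a \o eta2) t w].
Proof.
move=> c1 c2 It1 It2 e12 [k1 [hk1 [hy1 [v1 [d1 ->]]]]]
  [k2 [hk2 [hy2 [v2 [d2 /(congr1 (@tclass _ _ _)) /= tcl]]]]].
have [a ha ay] := atlas_cover (eta1 t).
have [[_ [df hdf _]] _] := hk1 a ha.
pose w := df (k1 (eta1 t), v1).
have aw : tangent_class k1 (eta1 t) v1 (a, w).
  split => //=; first exact: atlas_is_chart.
  by apply: hdf; exists (eta1 t).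
have [_ _ /= hw1] := aw.
have [_ _ /= hw2] : tangent_class k2 (eta2 t) v2 (a, w) by rewrite -tcl.
exists a, w; split => //.
- exact: (has_velocity_atlas c1 It1 hk1 ha hy1 ay d1 hw1).
- apply: (has_velocity_atlas c2 It2 hk2 ha hy2 _ d2 hw2).
  by rewrite -e12.
Qed.

End charts.

(** * Lipschitz estimates for pullbacks of C1 maps *)

(** In charts, [Psi (z1, u, x)] is jointly Lipschitz in [u] and [x].  The seminorm
    on the product model space that bounds the increments of the C1 map is split
    into its restrictions [q2] and [q3] to the two factors. *)
Lemma pullback_lipschitz (R : realType) (E E1 E2 : tvsType R)
    (M : C1manifold E) (N1 : C1manifold E1) (N2 : C1manifold E2)
    (V : set M) (Psi : prod_manifold (prod_manifold N1 N2) M -> M)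
    (z1 : N1) (z2 : N2) (y : M) (c2 : chart N2 E2) (c3 phi : chart M E)
    (p : E -> R) :
  open V ->
  C1_map_on (N := prod_manifold (prod_manifold N1 N2) M)
    (([set: N1] `*` [set: N2]) `*` V) Psi ->
  V y -> is_chart c2 -> is_chart c3 -> is_chart phi ->
  cdom c2 z2 -> cdom c3 y -> cdom phi (Psi ((z1, z2), y)) ->
  continuous_seminorm p ->
  exists (q2 : E2 -> R) (q3 : E -> R) (B2 : set N2) (B3 : set M),
    [/\ continuous_seminorm q2, continuous_seminorm q3, nbhs z2 B2, nbhs y B3 &
      forall u u' x x', B2 u -> B2 u' -> B3 x -> B3 x' ->
        cdom phi (Psi ((z1, u), x)) /\
        p (phi (Psi ((z1, u), x)) - phi (Psi ((z1, u'), x'))) <=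
          q2 (c2 u - c2 u') + q3 (c3 x - c3 x')].
Proof.
move=> oV [Psic PsiC1] Vy h2 h3 hphi d2 d3 dphi hp.
have [c1 a1 d1] := atlas_cover z1.
pose c := prod_chart (prod_chart c1 c2) c3.
have hc : is_chart (M := prod_manifold (prod_manifold N1 N2) M) c.
  apply: prod_is_chart => //; apply: prod_is_chart => //.
  exact: atlas_is_chart.
pose W := ([set: N1] `*` [set: N2]) `*` V.
have oW : open W by apply: open_setX => //; apply: open_setX; exact: openT.
have oP : open (W `&` Psi @^-1` cdom phi).
  by apply: open_preimage_within => //; exact: cdom_open.
have := PsiC1 c phi hc hphi; rewrite -setIA => GC1.
have oU := chart_image_open c oP.
set U := c @` _ in GC1 oU.
have Ux0 : U (c ((z1, z2), y)) by exists ((z1, z2), y).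
have [q [r [hq hr qr]]] := C1_on_lipschitz oU Ux0 GC1 hp.
pose i2 : E2 -> (E1 * E2) * E := fun u => ((0, u), 0).
pose i3 : E -> (E1 * E2) * E := fun v => ((0, 0), v).
have i2lin : linear i2.
  move=> a u v; rewrite /i2.
  by congr (_, _); [congr (_, _)|]; rewrite //= scaler0 addr0.
have i3lin : linear i3.
  move=> a u v; rewrite /i3.
  by congr (_, _); congr (_, _); rewrite /= scaler0 addr0.
pose I2 : {linear E2 -> ((E1 * E2) * E)%type} := HB.pack i2
  (GRing.isLinear.Build R E2 ((E1 * E2) * E)%type *:%R i2 i2lin).
pose I3 : {linear E -> ((E1 * E2) * E)%type} := HB.pack i3
  (GRing.isLinear.Build R E ((E1 * E2) * E)%type *:%R i3 i3lin).
have i2c : continuous I2.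
  move=> u.
  apply: (@cvg_pair _ _ _ (nbhs u) (nbhs ((0 : E1), u)) (nbhs (0 : E))).
    apply: (@cvg_pair _ _ _ (nbhs u) (nbhs (0 : E1)) (nbhs u)).
      exact: cvg_cst.
    exact: cvg_id.
  exact: cvg_cst.
have i3c : continuous I3.
  move=> u.
  apply: (@cvg_pair _ _ _ (nbhs u) (nbhs ((0, 0) : E1 * E2)) (nbhs u)).
    exact: cvg_cst.
  exact: cvg_id.
have split_csn (s : (E1 * E2) * E -> R) u v : continuous_seminorm s ->
    s ((0, u), v) <= s (i2 u) + s (i3 v).
  move=> [sD _ _]; apply: le_trans (sD _ _).
  rewrite le_eqVlt; apply/orP; left; apply/eqP; congr s.
  by rewrite /i2 /i3; congr (_, _); [congr (_, _)|]; rewrite /= ?addr0 ?add0r.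
have hq2 := csn_comp i2c hq; have hq3 := csn_comp i3c hq.
have hr2 := csn_comp i2c hr; have hr3 := csn_comp i3c hr.
have half0 : 0 < 2^-1 :> R by rewrite invr_gt0.
have n2 := chart_nbhs d2 (csn_ball (c2 z2) hr2 half0).
have n3 := chart_nbhs d3 (csn_ball (c3 y) hr3 half0).
exists (q \o I2), (q \o I3); eexists; eexists.
split; [exact: hq2|exact: hq3|exact: n2|exact: n3|].
move=> u u' x x' [d2u ru] [d2u' ru'] [d3x rx] [d3x' rx'].
have diff (e e' : E2) (k k' : E) :
    ((c1 z1, e), k) - ((c1 z1, e'), k') = ((0, e - e'), k - k') :> (E1 * E2) * E.
  by congr (_, _); congr (_, _); rewrite subrr.
have rle e k : r (i2 (e - c2 z2)) < 2^-1 -> r (i3 (k - c3 y)) < 2^-1 ->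
    r (((c1 z1, e), k) - c ((z1, z2), y)) < 1.
  move=> k1 k2; rewrite diff; apply: le_lt_trans (split_csn _ _ _ hr) _.
  lra.
have [] := qr _ _ (rle (c2 u) (c3 x) ru rx) (rle (c2 u') (c3 x') ru' rx').
move=> [[[w1 w2] w3] [[[dw1 dw2] dw3] [Ww Pw]] [e1 e2 e3]].
have {}e1 : w1 = z1 by rewrite -[LHS](cfunK dw1) e1 (cfunK d1).
have {}e2 : w2 = u by rewrite -[LHS](cfunK dw2) e2 (cfunK d2u).
have {}e3 : w3 = x by rewrite -[LHS](cfunK dw3) e3 (cfunK d3x).
rewrite e1 e2 e3 in Pw.
rewrite /= !cfunK// => le; split => //.
apply: le_trans le _; rewrite diff; exact: split_csn.
Qed.

(** * Solutions are flow lines *)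

Section flow_uniqueness.
Variables (R : realType) (E : tvsType R) (M : C1manifold E).
Variables (J : set R) (W : set (R * M)) (f : R * M -> tangent_bundle M).
Variables (I : set R) (V Y : set M) (Phi : R -> R -> M -> M).
Hypothesis I_itv : is_interval I.
Hypothesis V_open : open V.
Hypothesis Phi_solves : flow_solves W f I V Phi.
Hypotheses (Y_open : open Y) (YV : Y `<=` V).
Hypothesis Phi_comp : forall t0 t1 t2 y0, I t0 -> I t1 -> I t2 -> Y y0 ->
  Phi t2 t1 (Phi t1 t0 y0) = Phi t2 t0 y0.
Variables (E1 E2 : tvsType R) (N1 : C1manifold E1) (N2 : C1manifold E2).
Variables (zeta1 : R -> N1) (zeta2 : R -> N2).
Variable Psi : prod_manifold (prod_manifold N1 N2) M -> M.
Hypothesis zeta2_ac : abs_continuous I zeta2.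
Hypothesis Psi_C1 : C1_map_on (N := prod_manifold (prod_manifold N1 N2) M)
  (([set: N1] `*` [set: N2]) `*` V) Psi.
Hypothesis PhiE : forall t t0 y0, I t -> I t0 -> V y0 ->
  Phi t t0 y0 = Psi ((zeta1 t, zeta2 t0), y0).
Variable I0 : set R.
Hypotheses (I0m : measurable I0) (I0I : I0 `<=` I)
  (I0null : lebesgue_measure (I `\` I0) = 0%E).
Hypothesis Phi_deriv : forall t t0 y0, I0 t -> I t0 -> V y0 ->
  has_velocity I (fun s => Phi s t0 y0) t (f (t, Phi t t0 y0)).

Lemma flow_diag s y : I s -> V y -> Phi s s y = y.
Proof. by move=> Is Vy; have [_ _] := Phi_solves Is Vy. Qed.

Lemma flow_continuous s y : I s -> V y ->
  {within I, continuous (fun t => Phi t s y)}.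
Proof. by move=> Is Vy; have [[_ [c _] _ _] _ _] := Phi_solves Is Vy. Qed.

Lemma flow_lipschitz (t0 s : R) (y : M) (c2 : chart N2 E2) (c3 phi : chart M E)
    (p : E -> R) :
  I t0 -> I s -> V y -> is_chart c2 -> is_chart c3 -> is_chart phi ->
  cdom c2 (zeta2 s) -> cdom c3 y -> cdom phi (Phi t0 s y) ->
  continuous_seminorm p ->
  exists (q2 : E2 -> R) (q3 : E -> R) (B : set M) (d : R),
    [/\ continuous_seminorm q2, continuous_seminorm q3, nbhs y B, 0 < d &
      forall t t' x x', I t -> I t' -> `|t - s| < d -> `|t' - s| < d ->
        B x -> B x' -> V x -> V x' ->
        cdom phi (Phi t0 t x) /\
        p (phi (Phi t0 t x) - phi (Phi t0 t' x')) <=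
          q2 (c2 (zeta2 t) - c2 (zeta2 t')) + q3 (c3 x - c3 x')].
Proof.
move=> It0 Is Vy h2 h3 hphi d2 d3; rewrite PhiE// => dphi hp.
have [q2 [q3 [B2 [B3 [hq2 hq3 nB2 nB3 H]]]]] :=
  pullback_lipschitz V_open Psi_C1 Vy h2 h3 hphi d2 d3 dphi hp.
have [d d0 dP] := within_continuous_ball zeta2_ac.1 Is nB2.
exists q2, q3, B3, d; split => // t t' x x' It It' td td' Bx Bx' Vx Vx'.
by rewrite !PhiE//; apply: H => //; exact: dP.
Qed.

Variables (I1 : set R) (gamma : R -> M).
Hypothesis gamma_sol : caratheodory_solution W f I1 gamma.

Let gamma_cont : {within I1, continuous gamma}.
Proof. by have [_ [] ] := gamma_sol. Qed.

(** At the time [s], [gamma] and the flow line [kappa] through [gamma s] have the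
    same velocity, so they differ by [o(t - s)] in a chart.  By the composition
    law [Phi t0 t] sends [kappa t] to [Phi t0 s (gamma s)] for every [t], and
    [Phi t0 t] is Lipschitz. *)
Lemma pulled_back_derivative (t0 s : R) (phi : chart M E) (p : E -> R) (e : R) :
  I t0 -> I0 s -> I1 s -> Y (gamma s) ->
  has_velocity I1 gamma s (f (s, gamma s)) ->
  is_chart phi -> cdom phi (Phi t0 s (gamma s)) ->
  continuous_seminorm p -> 0 < e ->
  exists2 d : R, 0 < d & forall t, I t -> I1 t -> `|t - s| < d ->
    p (phi (Phi t0 s (gamma s)) - phi (Phi t0 t (gamma t))) <= e * `|t - s|.
Proof.
move=> It0 I0s I1s Ygs vel hphi dphi hp e0.
have Is := I0I I0s; have Vgs := YV Ygs.
pose kappa t := Phi t s (gamma s).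
have kappas : kappa s = gamma s by exact: flow_diag.
have kappac : {within I, continuous kappa} by exact: flow_continuous.
have velk : has_velocity I kappa s (f (s, gamma s)).
  by rewrite -kappas; exact: Phi_deriv.
have [a [w [ha da dg dk]]] :=
  equal_velocity gamma_cont kappac I1s Is (esym kappas) vel velk.
have [c2 h2 d2] := atlas_cover (zeta2 s).
have [q2 [q3 [B [d1 [hq2 hq3 nB d10 H]]]]] := flow_lipschitz It0 Is Vgs
  (atlas_is_chart h2) (atlas_is_chart ha) hphi d2 da dphi hp.
have nBV : nbhs (gamma s) (B `&` V) by apply: filterI => //; exact: open_nbhsW.
have nBVk : nbhs (kappa s) (B `&` V) by rewrite kappas.
have [d3 d30 H3] := within_continuous_ball gamma_cont I1s nBV.
have [d4 d40 H4] := within_continuous_ball kappac Is nBVk.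
have e2 : 0 < e / 2 by rewrite divr_gt0.
have [d5 d50 H5] := (has_deriv_inP _ _ _ _).1 dg q3 hq3 _ e2.
have [d6 d60 H6] := (has_deriv_inP _ _ _ _).1 dk q3 hq3 _ e2.
exists (Num.min d1 (Num.min d3 (Num.min d4 (Num.min d5 d6)))).
  by rewrite !lt_min d10 d30 d40 d50.
move=> t It I1t; rewrite !lt_min => /and5P[td1 td3 td4 td5 td6].
have [->|ts] := eqVneq t s.
  by rewrite !subrr (csn0 hp) normr0 mulr0.
have <- : Phi t0 t (kappa t) = Phi t0 s (gamma s) by exact: Phi_comp.
have [Bg Vg] := H3 t I1t td3; have [Bk Vk] := H4 t It td4.
have [_] := H t t (kappa t) (gamma t) It It td1 td1 Bk Bg Vk Vg.
rewrite subrr (csn0 hq2) add0r => /le_trans; apply.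
have h0 : t - s != 0 by rewrite subr_eq0.
have st : s + (t - s) = t by rewrite addrC subrK.
have := H5 (t - s) h0 td5; have := H6 (t - s) h0 td6; rewrite st /= kappas.
move=> /(_ It) k1 /(_ I1t) k2.
have := csn_triangle hq3 (a (kappa t)) (a (gamma s) + (t - s) *: w) (a (gamma t)).
rewrite (csnB hq3 (_ + _)) !opprD !addrA; lra.
Qed.

(** On a short interval around [s] the curve [Phi t0 t (gamma t)] is Lipschitz in
    terms of [zeta2] and [gamma], both of which have increments bounded by
    integrals; with the bound at almost every time this is the situation of
    [null_derivative_increment]. *)
Lemma pulled_back_locally_constant (t0 a b s : R) (phi : chart M E) (p : E -> R) :
  I t0 -> (forall t, a <= t <= b -> [/\ I t, I1 t & Y (gamma t)]) ->
  is_chart phi ->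
  (forall t, a <= t <= b -> cdom phi (Phi t0 t (gamma t))) ->
  continuous_seminorm p -> a <= s <= b ->
  exists2 d : R, 0 < d & forall t t', a <= t -> t <= t' -> t' <= b ->
    `|t - s| < d -> `|t' - s| < d ->
    p (phi (Phi t0 t (gamma t)) - phi (Phi t0 t' (gamma t'))) <= 0.
Proof.
move=> It0 ab hphi dphi hp sab.
have [Is I1s Ygs] := ab s sab; have Vgs := YV Ygs.
have [_ [_ /(_ s I1s)[al3 [be3 [c3 [_ sub3 near3 h3 [d3 [g3 gL3 gw3]]]]]]] _ vel] :=
  gamma_sol.
have [_ /(_ s Is)[al2 [be2 [c2 [_ sub2 near2 h2 [d2 [g2 gL2 gw2]]]]]]] := zeta2_ac.
have [r3 r30 R3] := within_nbhs_ball near3.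
have [r2 r20 R2] := within_nbhs_ball near2.
have in3 t : I1 t -> `|t - s| < r3 -> al3 <= t <= be3.
  by move=> I1t /(R3 t I1t); rewrite /= in_itv.
have in2 t : I t -> `|t - s| < r2 -> al2 <= t <= be2.
  by move=> It /(R2 t It); rewrite /= in_itv.
have ss (r : R) : 0 < r -> `|s - s| < r by rewrite subrr normr0.
have d2s := d2 s (in2 s Is (ss _ r20)).
have d3s := d3 s (in3 s I1s (ss _ r30)).
have [q2 [q3 [B [d [hq2 hq3 nB d0 H]]]]] := flow_lipschitz It0 Is Vgs
  h2 h3 hphi d2s d3s (dphi s sab) hp.
have [d' d'0 H'] := within_continuous_ball gamma_cont I1s nB.
exists (Num.min (Num.min r3 r2) (Num.min d d')).
  by rewrite !lt_min r30 r20 d0 d'0.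
move=> u u' au uu' u'b; rewrite !lt_min.
move=> /andP[/andP[ur3 ur2] /andP[ud ud']] /andP[/andP[u'r3 u'r2] /andP[u'd u'd']].
have uab : a <= u <= b by rewrite au (le_trans uu').
have u'ab : a <= u' <= b by rewrite u'b (le_trans au).
have [Iu I1u _] := ab u uab; have [Iu' I1u' _] := ab u' u'ab.
have /andP[l2 _] := in2 u Iu ur2; have /andP[_ m2] := in2 u' Iu' u'r2.
have /andP[l3 _] := in3 u I1u ur3; have /andP[_ m3] := in3 u' I1u' u'r3.
have uu'ab x : u <= x <= u' -> a <= x <= b.
  by move=> /andP[ux xu']; rewrite (le_trans au) ?(le_trans xu').
have near_s x : u <= x <= u' -> `|x - s| < d /\ `|x - s| < d'.
  move=> /andP[ux xu']; move: ud ud' u'd u'd'; rewrite !ltr_norml.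
  by move=> /andP[? ?] /andP[? ?] /andP[? ?] /andP[? ?]; split; lra.
pose D x y := p (phi (Phi t0 x (gamma x)) - phi (Phi t0 y (gamma y))).
pose rho x := q2 (g2 x) + q3 (g3 x).
have mI : measurable (`[u, u']%classic : set (measurableTypeR R)).
  exact: measurable_itv.
have int2 : lebesgue_measure.-integrable `[u, u'] (EFin \o (q2 \o g2)).
  apply: integrableS (L1_path_integrable gL2 hq2) => //.
  by apply: subset_itv; rewrite bnd_simp.
have int3 : lebesgue_measure.-integrable `[u, u'] (EFin \o (q3 \o g3)).
  apply: integrableS (L1_path_integrable gL3 hq3) => //.
  by apply: subset_itv; rewrite bnd_simp.
apply: (@null_derivative_increment R D rho u u'
  ((I `\` I0) `|` ~` [set t | I1 t -> has_velocity I1 gamma t (f (t, gamma t))])).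
- exact: uu'.
- by move=> x y; exact: csnB.
- by move=> x y z; exact: csn_triangle.
- by move=> x; rewrite addr_ge0 ?csn_ge0.
- have := integrableD mI int2 int3.
  by apply: eq_integrable.
- move=> x y ux xy yu'.
  have xuu' : u <= x <= u' by rewrite ux (le_trans xy).
  have yuu' : u <= y <= u' by rewrite yu' (le_trans ux).
  have [Ix I1x Yx] := ab x (uu'ab x xuu'); have [Iy I1y Yy] := ab y (uu'ab y yuu').
  have [xd xd'] := near_s x xuu'; have [yd yd'] := near_s y yuu'.
  have [_] := H x y (gamma x) (gamma y) Ix Iy xd yd
    (H' x I1x xd') (H' y I1y yd') (YV Yx) (YV Yy).
  move=> /le_trans; apply.
  have xys : (`]x, y] `<=` `[u, u'])%classic.
    by apply: subset_itv; rewrite bnd_simp.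
  rewrite /rho RintegralD//; last 2 first.
  + exact: integrableS int2.
  + exact: integrableS int3.
  rewrite (csnB hq2) (csnB hq3); apply: lerD.
  + apply: (@weak_integral_csn_le _ _ al2 be2 g2 (c2 \o zeta2)) => //.
      exact: le_trans ux.
    exact: le_trans m2.
  + apply: (@weak_integral_csn_le _ _ al3 be3 g3 (c3 \o gamma)) => //.
      exact: le_trans ux.
    exact: le_trans m3.
- apply: negligibleU; last exact: vel.
  exists (I `\` I0); split => //.
  apply: measurableD => //; exact: is_interval_measurable.
- move=> x xuu' nZ e e0.
  have [Ix I1x Yx] := ab x (uu'ab x xuu').
  have I0x : I0 x by apply: contrapT => n; apply: nZ; left.
  have velx : has_velocity I1 gamma x (f (x, gamma x)).
    by apply: contrapT => n; apply: nZ; right => /(_ I1x).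
  have [r r0 rP] := pulled_back_derivative It0 I0x I1x Yx velx hphi
    (dphi x (uu'ab x xuu')) hp e0.
  exists r => // t tuu' txr; have [It I1t _] := ab t (uu'ab t tuu').
  exact: rP.
Qed.

(** The length of the intervals on which constancy is known depends on [p] and
    [s], so the intervals are glued separately for each [p]; then the seminorms
    separate the points of the model space. *)
Lemma pulled_back_constant (t0 a b : R) (phi : chart M E) :
  I t0 -> (forall t, a <= t <= b -> [/\ I t, I1 t & Y (gamma t)]) ->
  is_chart phi -> a <= b ->
  (forall t, a <= t <= b -> cdom phi (Phi t0 t (gamma t))) ->
  Phi t0 a (gamma a) = Phi t0 b (gamma b).
Proof.
move=> It0 abP hphi ab dphi.
have aab : a <= a <= b by rewrite lexx.
have bab : a <= b <= b by rewrite ab lexx.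
rewrite -(cfunK (dphi a aab)) -(cfunK (dphi b bab)); congr (cinv phi _).
apply: csn_separates => [|p hp]; first exact: (model_hausdorff M).
apply/le_anti; rewrite (csn_ge0 hp) andbT.
pose D x y := p (phi (Phi t0 x (gamma x)) - phi (Phi t0 y (gamma y))).
rewrite -[leRHS](subrr (0 : R)).
apply: (@local_to_global R D (fun=> 0) a b ab) => [x y z|s sab].
  exact: csn_triangle.
have [d d0 H] := pulled_back_locally_constant It0 abP hphi dphi hp sab.
exists d => // t /andP[at_ tb] tsd; have /andP[as_ sb] := sab.
have ssd : `|s - s| < d by rewrite subrr normr0.
by rewrite subrr; split=> [st|ts]; apply: H.
Qed.

(** From [Phi t0 t (gamma t) = gamma t0], applying [Phi t t0] and the composition
    law gives [gamma t]. *)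
Lemma solution_is_flow_line (t0 : R) :
  (exists2 O : set R, open O & I = J `&` O) -> I1 `<=` J ->
  I t0 -> I1 t0 -> Y (gamma t0) ->
  exists2 d : R, 0 < d & forall t, I1 t -> `|t - t0| < d ->
    gamma t = Phi t t0 (gamma t0).
Proof.
move=> [G oG IE] I1J It0 I1t0 Yg0; have Vg0 := YV Yg0.
have [[I1_itv _] _ _ _] := gamma_sol.
have [phi hphi dphi0] := atlas_cover (gamma t0).
have [c2 h2 d2] := atlas_cover (zeta2 t0).
have dphi1 : cdom phi (Phi t0 t0 (gamma t0)) by rewrite flow_diag.
(* With the zero seminorm, the Lipschitz estimate still says that the curve
   pulled back to time [t0] stays in the domain of [phi]. *)
have zero_csn : continuous_seminorm (fun _ : E => 0 : R).
  split; [by move=> *; rewrite addr0|by move=> *; rewrite mulr0|].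
  by move=> x; exact: cvg_cst.
have [q2 [q3 [B [d1 [_ _ nB d10 H]]]]] := flow_lipschitz It0 It0 Vg0
  (atlas_is_chart h2) (atlas_is_chart hphi) (atlas_is_chart hphi) d2 dphi0 dphi1
  zero_csn.
have nBY : nbhs (gamma t0) (B `&` Y) by apply: filterI => //; exact: open_nbhsW.
have [d3 d30 H3] := within_continuous_ball gamma_cont I1t0 nBY.
have [d4 /= d40 H4] : exists2 d : R, 0 < d & forall t, `|t - t0| < d -> G t.
  have : nbhs t0 G by apply: open_nbhsW => //; move: It0; rewrite IE => -[].
  move=> /nbhs_ballP[d /= d0 dP]; exists d => // t td; apply: dP.
  by rewrite -ball_normE /= distrC.
exists (Num.min d1 (Num.min d3 d4)); first by rewrite !lt_min d10 d30.
set d := Num.min _ _.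
have good s : I1 s -> `|s - t0| < d ->
    [/\ I s, I1 s, Y (gamma s) & cdom phi (Phi t0 s (gamma s))].
  rewrite !lt_min => I1s /and3P[s1 s3 s4].
  have [Bs Ys] := H3 s I1s s3.
  have Is : I s by rewrite IE; split; [exact: I1J|exact: H4].
  split => //.
  by have [] := H s s (gamma s) (gamma s) Is Is s1 s1 Bs Bs (YV Ys) (YV Ys).
move=> t I1t td; have [It _ Yt _] := good t I1t td.
have eta_t : Phi t0 t (gamma t) = gamma t0.
  rewrite -[RHS](@flow_diag t0)//.
  have [t0t|tt0] := leP t0 t.
    have seg s : t0 <= s <= t ->
        [/\ I s, I1 s, Y (gamma s) & cdom phi (Phi t0 s (gamma s))].
      move=> st; have /andP[s0 s1] := st; apply: good.
        exact: (I1_itv t0 t I1t0 I1t).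
      by apply: le_lt_trans td; rewrite !ger0_norm ?subr_ge0// lerD2r.
    apply/esym/(@pulled_back_constant t0 t0 t phi) => //.
    - by move=> s /seg[].
    - exact: atlas_is_chart.
    - by move=> s /seg[].
  have seg s : t <= s <= t0 ->
      [/\ I s, I1 s, Y (gamma s) & cdom phi (Phi t0 s (gamma s))].
    move=> st; have /andP[s0 s1] := st; apply: good.
      exact: (I1_itv t t0 I1t I1t0).
    apply: le_lt_trans td.
    rewrite distrC (distrC t) !ger0_norm ?subr_ge0 ?(ltW tt0)//.
    by rewrite lerD2l lerN2.
  apply: (@pulled_back_constant t0 t t0 phi) => //.
  - by move=> s /seg[].
  - exact: atlas_is_chart.
  - exact: ltW.
  - by move=> s /seg[].
by rewrite -eta_t Phi_comp// flow_diag//; exact: YV.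
Qed.

End flow_uniqueness.

(** * Local existence and local uniqueness *)

Theorem proposition1p1 (R : realType) (E : tvsType R) (hE : frechet E)
    (M : C1manifold E) (J : set R) (hJ : nondegenerate_interval J)
    (W : set (R * M)) (hW : relatively_open (J `*` [set: M]) W)
    (f : R * M -> tangent_bundle M)
    (hf : forall (t : R) (y : M), W (t, y) -> tbase (f (t, y)) = y)
    (hflow : local_flows_pullback_C1 J W f) :
  local_existence J W f /\ local_uniqueness W f.
Proof.
split=> [t0 y0 Wt0|I1 I2 gamma1 gamma2 t0 sol1 sol2 I1t0 I2t0 g12].
  have [I [V [Phi [[_ IJ It0] [[_ Vy0 _] [sol _ _]]]]]] := hflow t0 y0 Wt0.
  exists I, (fun t => Phi t t0 y0); split => //.
  exact: sol.
have WJ I3 gamma : caratheodory_solution W f I3 gamma -> I3 `<=` J.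
  move=> [_ _ gW _] t /gW; case: hW => O _ ->.
  by move=> [[]].
have Wt0 : W (t0, gamma1 t0) by have [_ _ gW _] := sol1; exact: gW.
have [I [V [Phi [[I_itv IJ It0] [[oV _ _] [sol [Y [oY Yy0 YV _ Phic]]
  [[E1 [E2 [N1 [N2 [zeta1 [zeta2 [Psi [_ _ z2ac PsiC1 PhiE]]]]]]]]
   [I0 [I0m I0I I0null I0vel]]]]]]]]] := hflow t0 (gamma1 t0) Wt0.
have key I3 gamma : caratheodory_solution W f I3 gamma -> I3 t0 ->
    gamma t0 = gamma1 t0 ->
    exists2 d : R, 0 < d & forall t, I3 t -> `|t - t0| < d ->
      gamma t = Phi t t0 (gamma1 t0).
  move=> sol3 I3t0 g3; rewrite -g3.
  apply: (solution_is_flow_line I_itv oV sol oY YV Phic z2ac PsiC1 PhiE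
    I0m I0I I0null I0vel sol3 IJ (WJ _ _ sol3) It0 I3t0).
  by rewrite g3.
have [d1 d10 H1] := key _ _ sol1 I1t0 erefl.
have [d2 d20 H2] := key _ _ sol2 I2t0 (esym g12).
pose d := Num.min d1 d2.
have d0 : 0 < d by rewrite lt_min d10.
have [[I1_itv _] _ _ _] := sol1; have [[I2_itv _] _ _ _] := sol2.
exists ((I1 `&` I2) `&` ball t0 d); split.
- move=> x y [[I1x I2x]]; rewrite -ball_normE /= => xd [[I1y I2y] yd] z xzy.
  split; first by split; [exact: (I1_itv x y)|exact: (I2_itv x y)].
  have /andP[xz zy] := xzy; move: xd yd; rewrite /= !ltr_norml.
  by move=> /andP[? ?] /andP[? ?]; apply/andP; split; lra.
- by split => //; exact: ballxx.
- by exists (ball t0 d) => //; exact: ball_open.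
- move=> t [[I1t I2t]]; rewrite -ball_normE /= distrC lt_min => /andP[td1 td2].
  by rewrite H1// H2.
Qed.
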